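(* Let $n\ge 2$, let $x_1,\dots,x_n$ be coordinates on $X=\mathbb{C}^n$, and let $D=(f)\subset X$ with $f\in\mathcal{O}$ be a divisor. Let $k\in\mathbb{Z}$, $d\in\mathbb{N}$ and $P\in F_d\mathcal{D}$. Then $P\in\mathcal{V}^D_k$ if and only if $$\forall\alpha\in\mathbb{N}^n,\ l\in\mathbb{N}:\quad |\alpha|+l\le d\ \Rightarrow\ P(x^\alpha f^l)\in\mathcal{O}\cdot f^{l-k}.$$
   Context: $\mathcal{O}$ is the sheaf of holomorphic functions on $X$, $\mathcal{D}$ the sheaf of differential operators on $X$ with holomorphic coefficients, and $F_d\mathcal{D}$ the operators of order at most $d$. A divisor $D\subset X$ is a (reduced) hypersurface with ideal sheaf $\mathcal{I}\subset\mathcal{O}$; $D=(f)$ means $\mathcal{I}=\mathcal{O}\cdot f$. The V-filtration along $D$ is $\mathcal{V}^D_k=\{P\in\mathcal{D}\mid \forall l\in\mathbb{Z}: P(\mathcal{I}^l)\subset\mathcal{I}^{l-k}\}$ for $k\in\mathbb{Z}$, with $\mathcal{I}^l=\mathcal{O}$ for $l\le 0$. If $l-k<0$, then $\mathcal{O}\cdot f^{l-k}$ is a submodule of the meromorphic functions containing $\mathcal{O}$, so the corresponding condition is automatic. Here $0\in\mathbb{N}$, $x^\alpha=x_1^{\alpha_1}\cdots x_n^{\alpha_n}$ and $|\alpha|=\alpha_1+\dots+\alpha_n$. *)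

(* Defs.v *)
From mathcomp Require Import all_boot all_order all_algebra.
From mathcomp Require Import complex.
From mathcomp Require Import all_classical all_reals all_analysis.

Set Implicit Arguments.
Unset Strict Implicit.
Unset Printing Implicit Defensive.

Import Order.TTheory GRing.Theory Num.Theory.
Import numFieldNormedType.Exports.

Local Open Scope classical_set_scope.
Local Open Scope ring_scope.

(* The annotation makes the scalars carry their norm topology, so that
   [differentiable] and ['D_v] below are C-linear notions. *)
Definition Cplx (R : realType) : numFieldType := (complex R : numFieldType).

Definition Cn (R : realType) (n : nat) : normedModType (Cplx R) := 'rV[Cplx R]_n.

Section Definitions.
Variables (R : realType) (n : nat).
Local Notation C := (Cplx R).
Local Notation X := (Cn R n).

(* Local functions are represented by total functions X -> C; a section over an
   open set W is only meaningful, and only constrained, on W. *)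
Definition holomorphic (W : set X) (g : X -> C) : Prop :=
  forall x, W x -> differentiable g x.

(* Meromorphic members of O f^m (m < 0) are constrained off the zeros of f only,
   because [f x ^ m] has no meaning at a zero of f.  Global generators over W
   suffice: O f^m is free of rank one when f vanishes on no open set. *)
Definition multiple_of_power (f : X -> C) (m : int) (W : set X) (g : X -> C)
    : Prop :=
  exists2 h, holomorphic W h &
    forall x, W x -> 0 <= m \/ f x != 0 -> g x = h x * f x ^ m.

(* Locally the zero set of one holomorphic function which vanishes identically
   on no nonempty open set.  The empty divisor is allowed. *)
Definition divisor (D : set X) : Prop :=
  forall p : X, exists U : set X, exists h : X -> C,
    [/\ open U, U p, holomorphic U h,
        (U `&` [set x | h x = 0])° = set0
      & D `&` U = U `&` [set x | h x = 0]].

(* Since D carries its reduced structure, its ideal sheaf is the full vanishing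
   ideal. *)
Definition ideal_sheaf (D W : set X) (g : X -> C) : Prop :=
  holomorphic W g /\ (forall x, W x -> D x -> g x = 0).

Definition principal_divisor (D : set X) (f : X -> C) : Prop :=
  divisor D /\
  forall (W : set X) (g : X -> C), open W ->
    ideal_sheaf D W g <-> multiple_of_power f 1 W g.

(* The m-th power of the ideal I(W), an ideal of O(W); for m = 0 it is O(W). *)
Definition ideal_power (D : set X) (m : nat) (W : set X) (g : X -> C) : Prop :=
  exists N (c : 'I_N -> X -> C) (s : 'I_N -> 'I_m -> X -> C),
    [/\ forall i, holomorphic W (c i),
        forall i j, ideal_sheaf D W (s i j)
      & forall x, W x -> g x = \sum_i c i x * \prod_j s i j x].

(* The sheaf I^l: sheafification of the presheaf of l-th powers, and O for
   l <= 0. *)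
Definition ideal_sheaf_power (D : set X) (l : int) (W : set X) (g : X -> C)
    : Prop :=
  forall p, W p -> exists W' : set X,
    [/\ open W', W' p, W' `<=` W
      & ideal_power D (if l is Posz m then m else 0%N) W' g].

Definition partial (i : 'I_n) (g : X -> C) : X -> C :=
  'D_(delta_mx 0 i : X) g.

(* Iterated partials of a holomorphic function commute, so the order chosen here
   is immaterial. *)
Definition mpartial (b : 'I_n -> nat) (g : X -> C) : X -> C :=
  foldr (fun i => iter (b i) (partial i)) g (enum 'I_n).

(* P is a section over U of F_d D: P = \sum_(|b| <= d) a_b \partial^b with a_b
   holomorphic on U.  As |b| <= d bounds every entry of b, such multi-indices
   live in the finite type of functions 'I_n -> 'I_d.+1. *)
Definition diffop_order (d : nat) (U : set X) (P : (X -> C) -> (X -> C))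
    : Prop :=
  exists2 a : {ffun 'I_n -> 'I_d.+1} -> X -> C,
    forall b, holomorphic U (a b) &
    forall (W : set X) (g : X -> C), open W -> W `<=` U -> holomorphic W g ->
    forall x, W x ->
      P g x = \sum_(b : {ffun 'I_n -> 'I_d.+1} | (\sum_i b i <= d)%N)
                a b x * mpartial (fun i => b i) g x.

(* The order of a section of D is only locally bounded. *)
Definition diffop (U : set X) (P : (X -> C) -> (X -> C)) : Prop :=
  forall p, U p -> exists U' : set X, exists d,
    [/\ open U', U' p, U' `<=` U & diffop_order d U' P].

Definition V_filtration (D : set X) (k : int) (U : set X)
    (P : (X -> C) -> (X -> C)) : Prop :=
  diffop U P /\
  forall (l : int) (W : set X) (g : X -> C), open W -> W `<=` U ->
    ideal_sheaf_power D l W g -> ideal_sheaf_power D (l - k) W (P g).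

Definition monomial (a : 'I_n -> nat) (x : X) : C :=
  \prod_i (x : 'rV[C]_n) 0 i ^+ a i.

End Definitions.

(* Main.v *)
From HB Require Import structures.
Require Import Defs.
From mathcomp Require Import all_boot all_order all_algebra.
From mathcomp Require Import complex ring lra.
From mathcomp Require Import all_classical all_reals all_analysis.

Set Implicit Arguments.
Unset Strict Implicit.
Unset Printing Implicit Defensive.

Import Order.TTheory GRing.Theory Num.Theory.
Import numFieldNormedType.Exports.

Local Open Scope classical_set_scope.
Local Open Scope ring_scope.

(* P is determined at a point p by its values on Taylor monomials.  Expanding
   h by Taylor at p, and f^m in powers of f - f(p), gives
     P(h f^m)(p) = sum over s + j <= d of a holomorphic function of p times
                   f(p)^(m - j) P((x - p)^beta (f - f(p))^j)(p),  |beta| = s,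
   since P kills what vanishes to order > d at p.  Multiplying out, the last
   factor is a combination of values P(x^alpha f^i)(p) with |alpha| + i <= d,
   so the test implies P(h f^m) in O f^(m - k).  Equalities known off the zeros
   of f extend by density.
   The coefficients are holomorphic because partial derivatives of C-linearly
   differentiable functions are again differentiable, which rests on a Cauchy
   estimate |G'(0)| <= 4 M / r.  With G'(0) = -1 and H = (G - G(0) + z) / z^2,
   the form Im(H dz) is closed off 0 and o(1 / |z|) at 0, so Goursat's bisection
   makes its integral along the boundary of a square vanish; were M < r / 4, the
   term 1 / z of H would make that integral positive on every edge. *)

(** * Goursat's theorem for real differential forms *)

(** Expanding [f] itself in coordinates would lose divisibility by [f]. Instead [f - f(p)] is
    treated as one more centred coordinate: like [x_i - p_i] it vanishes at [p], so products of more
    than [d] such factors are killed, which is why the test counts [|alpha| + l]. When a factor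
    [f - f(p)] is opened, [f] stays inside [P] and raises the tested exponent, while [f(p)] leaves
    [P] and raises the exponent of the multiple; both routes gain exactly one power of [f]. The
    argument of [P] depends on [p], but for fixed [p] linearity over constants suffices, and the
    constants that come out are holomorphic in [p]. Holomorphy means only complex differentiability
    at each point, so continuity of the derivative may not be presupposed. All higher estimates come
    from applying the first-order Cauchy estimate again, to differences [u(z + h) - u(z)] and to
    differences of difference quotients. Goursat's argument in turn uses only primitives along
    lines, so a boundary integral is a sum of four increments. *)

Lemma eqW (disp : Order.disp_t) (T : porderType disp) (x y : T) :
  x = y -> (x <= y)%O.
Proof. by move=> ->. Qed.

Section RealForms.
Variable R : realType.
Implicit Types (phi Phi : R -> R) (a b x y : R).

Lemma exists_primitive phi a b : continuous phi ->
  exists Phi, forall x, a <= x <= b -> is_derive x 1 Phi (phi x).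
Proof.
move=> cphi.
(* Starting at [a - 1] makes [x = a] an interior point of the interval of integration. *)
exists (fun x => \int[@lebesgue_measure R]_(t in [set` `[a - 1, x]]) phi t)%R.
move=> x /andP[ax xb].
have [] := @continuous_FTC1_closed R phi (a - 1) x (b + 1).
- by rewrite ltr_pwDr.
- apply: continuous_compact_integrable; first exact: segment_compact.
  exact: continuous_subspaceT.
- by rewrite ltrBlDr ltr_pwDr.
- exact: cphi.
by move=> dF <-; rewrite derive1E; exact: derivableP.
Qed.

Lemma derive_le_increment Phi phi a b M : a <= b ->
  (forall x, a <= x <= b -> is_derive x 1 Phi (phi x)) ->
  (forall x, a <= x <= b -> phi x <= M) ->
  Phi b - Phi a <= M * (b - a).
Proof.
move=> ab dPhi phiM.
have [||c] := @MVT_segment R Phi phi a b ab.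
- move=> x; rewrite in_itv/= => /andP[ax xb].
  by apply: dPhi; rewrite !ltW.
- apply: derivable_within_continuous => x; rewrite in_itv/= => xab.
  by have := dPhi x xab => -[].
rewrite in_itv/= => cab ->; apply: ler_wpM2r; first by rewrite subr_ge0.
exact: phiM.
Qed.

Lemma derive_ge_increment Phi phi a b M : a <= b ->
  (forall x, a <= x <= b -> is_derive x 1 Phi (phi x)) ->
  (forall x, a <= x <= b -> M <= phi x) ->
  M * (b - a) <= Phi b - Phi a.
Proof.
move=> ab dPhi phiM.
have := @derive_le_increment (- Phi) (- phi) a b (- M) ab.
have dN x : a <= x <= b -> is_derive x 1 (- Phi) ((- phi) x).
  by move=> /dPhi H; apply: is_deriveN.
move=> /(_ dN); rewrite mulNr !fctE => H.
rewrite -lerN2; apply: le_trans (H _) => //; last first.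
  by move=> x /phiM; rewrite lerN2.
by rewrite opprB [- Phi b - _]addrC opprK.
Qed.

Lemma derive_norm_increment Phi phi a b M : a <= b ->
  (forall x, a <= x <= b -> is_derive x 1 Phi (phi x)) ->
  (forall x, a <= x <= b -> `|phi x| <= M) ->
  `|Phi b - Phi a| <= M * (b - a).
Proof.
move=> ab dPhi phiM; rewrite ler_norml; apply/andP; split.
- rewrite -mulNr; apply: (derive_ge_increment ab dPhi) => x /phiM.
  by rewrite ler_norml => /andP[].
- apply: (derive_le_increment ab dPhi) => x /phiM.
  by rewrite ler_norml => /andP[].
Qed.

(** The subtracted term is the exact integral of the affine function [c0 + c1 * x]; keeping it exact
    lets the affine parts of the four edges cancel in [circulation_small]. *)
Lemma edge_estimate Phi phi a b (c0 c1 e : R) : a <= b ->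
  (forall x, a <= x <= b -> is_derive x 1 Phi (phi x)) ->
  (forall x, a <= x <= b -> `|phi x - (c0 + c1 * x)| <= e) ->
  `|Phi b - Phi a - (c0 * (b - a) + c1 * (b ^+ 2 - a ^+ 2) / 2)|
    <= e * (b - a).
Proof.
move=> ab dPhi phiM.
pose Psi x := Phi x - (c0 * x + c1 / 2 * x ^+ 2).
pose psi x := phi x - (c0 + c1 * x).
have dPsi x : a <= x <= b -> is_derive x 1 Psi (psi x).
  move=> /dPhi H; rewrite /Psi.
  apply: is_derive_eq.
  rewrite /psi /GRing.scale /=; congr (_ - _).
  by field.
have := derive_norm_increment ab dPsi phiM.
by apply: le_trans; apply: eqW; congr (`|_|); rewrite /Psi; field.
Qed.

End RealForms.

Lemma nested_intervals (R : realType) (u v : nat -> R) :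
  nondecreasing_seq u -> nonincreasing_seq v -> (forall n, u n <= v n) ->
  exists x, forall n, u n <= x <= v n.
Proof.
move=> undec vninc uv.
have uvmn m n : u m <= v n.
  case/orP: (leq_total m n) => mn; first by apply: le_trans (uv n);
    exact: undec.
  by apply: le_trans (uv m) _; exact: vninc.
have ne : range u !=set0 by exists (u 0); exists 0.
exists (sup (range u)) => n; apply/andP; split.
- by apply: ub_le_sup; [exists (v 0) => _ [m _ <-]|exists n].
- by apply: ge_sup => // _ [m _ <-].
Qed.

Lemma exists_small_halves (R : realType) (w e : R) : 0 < e ->
  exists n, w / 2 ^+ n < e.
Proof.
move=> e0; pose n := Num.truncn (w / e).
exists n.+1; rewrite ltr_pdivrMr ?exprn_gt0// mulrC -ltr_pdivrMr//.
apply: lt_le_trans (Num.Theory.truncnS_gt _) _.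
by rewrite -natrX ler_nat ltnW// ltn_expl.
Qed.

Section Goursat.
Variables (R : realType) (A B U V : R -> R -> R).

(* The integral of A dx + B dy along the boundary of [x1, x2] x [y1, y2], when
   U is a primitive of A in x and V is a primitive of B in y. *)
Definition rect_circulation (x1 x2 y1 y2 : R) : R :=
  (U x2 y1 - U x1 y1) + (V x2 y2 - V x2 y1) -
  (U x2 y2 - U x1 y2) - (V x1 y2 - V x1 y1).
Local Notation J := rect_circulation.

Definition in_rect (x1 x2 y1 y2 x y : R) := x1 <= x <= x2 /\ y1 <= y <= y2.

Definition line_primitives (x1 x2 y1 y2 : R) := forall x y,
  in_rect x1 x2 y1 y2 x y ->
  is_derive x 1 (U^~ y) (A x y) /\ is_derive y 1 (V x) (B x y).

(* Sharing the coefficient b between the two expansions expresses that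
   A dx + B dy is closed at (x0, y0). *)
Definition closed_form_at (x1 x2 y1 y2 x0 y0 : R) := exists a b c : R,
  forall e, 0 < e -> exists2 delta, 0 < delta & forall x y,
    in_rect x1 x2 y1 y2 x y -> `|x - x0| < delta -> `|y - y0| < delta ->
    `|A x y - (A x0 y0 + a * (x - x0) + b * (y - y0))|
      <= e * (`|x - x0| + `|y - y0|) /\
    `|B x y - (B x0 y0 + b * (x - x0) + c * (y - y0))|
      <= e * (`|x - x0| + `|y - y0|).

(** The affine parts cancel around the rectangle because [b] is shared. What remains is an error of
    at most [e * (w + h)] times the length of each edge, and the perimeter is [2 * (w + h)]. *)
Lemma circulation_small (x1 x2 y1 y2 x0 y0 : R) :
  line_primitives x1 x2 y1 y2 -> closed_form_at x1 x2 y1 y2 x0 y0 ->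
  forall e, 0 < e -> exists2 delta, 0 < delta & forall u v w h,
    0 <= w < delta -> 0 <= h < delta ->
    x1 <= u -> u + w <= x2 -> y1 <= v -> v + h <= y2 ->
    u <= x0 <= u + w -> v <= y0 <= v + h ->
    `|J u (u + w) v (v + h)| <= 2 * e * (w + h) ^+ 2.
Proof.
move=> prim [a [b [c cl]]] e e0.
have [delta d0 {}cl] := cl e e0; exists delta => // u v w h.
move=> /andP[w0 wd] /andP[h0 hd] xu ux yv vy /andP[ux0 x0u] /andP[vy0 y0v].
have inR x y : u <= x <= u + w -> v <= y <= v + h -> in_rect x1 x2 y1 y2 x y.
  by move=> /andP[? ?] /andP[? ?]; split; lra.
have clR x y : u <= x <= u + w -> v <= y <= v + h ->
    `|A x y - (A x0 y0 + a * (x - x0) + b * (y - y0))| <= e * (w + h) /\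
    `|B x y - (B x0 y0 + b * (x - x0) + c * (y - y0))| <= e * (w + h).
  move=> xuw yvh; have := inR x y xuw yvh.
  move: xuw yvh => /andP[? ?] /andP[? ?] Rxy.
  have xw : `|x - x0| <= w by rewrite ler_norml; lra.
  have yh : `|y - y0| <= h by rewrite ler_norml; lra.
  have [] := cl x y Rxy; [lra|lra|move=> HA HB].
  have le : e * (`|x - x0| + `|y - y0|) <= e * (w + h).
    by rewrite ler_pM2l// lerD.
  by split; [apply: le_trans HA le|apply: le_trans HB le].
have uw : u <= u + w by lra.
have vh : v <= v + h by lra.
have EA y : v <= y <= v + h -> `|U (u + w) y - U u y -
    ((A x0 y0 - a * x0 + b * (y - y0)) * ((u + w) - u) +
     a * ((u + w) ^+ 2 - u ^+ 2) / 2)| <= e * (w + h) * ((u + w) - u).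
  move=> yvh; apply: (@edge_estimate R (U^~ y) (A^~ y)) => // x xuw.
    by have [] := prim x y (inR x y xuw yvh).
  have [+ _] := clR x y xuw yvh.
  by congr (is_true (`|_| <= _)); ring.
have EB x : u <= x <= u + w -> `|V x (v + h) - V x v -
    ((B x0 y0 + b * (x - x0) - c * y0) * ((v + h) - v) +
     c * ((v + h) ^+ 2 - v ^+ 2) / 2)| <= e * (w + h) * ((v + h) - v).
  move=> xuw; apply: (@edge_estimate R (V x) (B x)) => // y yvh.
    by have [] := prim x y (inR x y xuw yvh).
  have [_] := clR x y xuw yvh.
  by congr (is_true (`|_| <= _)); ring.
have := EA v; have := EA (v + h); have := EB u; have := EB (u + w).
rewrite !lexx uw vh => /(_ isT) + /(_ isT) + /(_ isT) + /(_ isT).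
rewrite /J !ler_norml => /andP[? ?] /andP[? ?] /andP[? ?] /andP[? ?].
by apply/andP; split; lra.
Qed.

Lemma goursat_rectangle (x1 x2 y1 y2 : R) : x1 <= x2 -> y1 <= y2 ->
  line_primitives x1 x2 y1 y2 ->
  (forall x y, in_rect x1 x2 y1 y2 x y -> closed_form_at x1 x2 y1 y2 x y) ->
  J x1 x2 y1 y2 = 0.
Proof.
move=> x12 y12 prim cl; apply/eqP/negP => /negP J0.
pose w n := (x2 - x1) / 2 ^+ n; pose h n := (y2 - y1) / 2 ^+ n.
pose e0 := `|J x1 x2 y1 y2|; have e0_gt0 : 0 < e0 by rewrite normr_gt0.
have w_ge0 n : 0 <= w n by rewrite divr_ge0 ?exprn_ge0// subr_ge0.
have h_ge0 n : 0 <= h n by rewrite divr_ge0 ?exprn_ge0// subr_ge0.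
have wS n : w n = 2 * w n.+1 by rewrite /w exprS; field; rewrite expf_neq0.
have hS n : h n = 2 * h n.+1 by rewrite /h exprS; field; rewrite expf_neq0.
(* Invariant of the bisection: the rectangle with lower left corner [p] and sides halved [n] times
   carries at least the fraction [4 ^- n] of the original circulation. *)
pose bad n (p : R * R) :=
  [/\ x1 <= p.1, p.1 + w n <= x2, y1 <= p.2, p.2 + h n <= y2 &
      e0 <= 4 ^+ n * `|J p.1 (p.1 + w n) p.2 (p.2 + h n)|].
pose sub n (p q : R * R) :=
  [/\ p.1 <= q.1, q.1 + w n.+1 <= p.1 + w n,
      p.2 <= q.2 & q.2 + h n.+1 <= p.2 + h n].
have step (np : nat * (R * R)) :
    exists q, bad np.1 np.2 -> bad np.1.+1 q /\ sub np.1 np.2 q.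
  case: np => n [x y] /=.
  have [bp|nbp] := pselect (bad n (x, y)); last by exists (0, 0).
  case: bp => /= bx bx' by_ by' bJ.
  have wS' := wS n; have hS' := hS n.
  have := w_ge0 n.+1; have := h_ge0 n.+1.
  move: wS' hS' bx' by' bJ; rewrite /bad /sub /=.
  move: (w n) (w n.+1) (h n) (h n.+1) => wn w' hn h' -> -> bx' by' bJ h'0 w'0.
  (* Integrals along inner edges cancel, so the four quarters add up to the whole; if none
     qualified, their sum would stay below the bound. *)
  apply: contrapT => /forallNP Hn.
  have Hq q : x <= q.1 -> q.1 + w' <= x + 2 * w' -> y <= q.2 ->
      q.2 + h' <= y + 2 * h' ->
      4 ^+ n.+1 * `|J q.1 (q.1 + w') q.2 (q.2 + h')| < e0.
    move=> ? ? ? ?; have := Hn q => /not_implyP[_].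
    by move=> Hq; rewrite ltNge; apply/negP => Hle; apply: Hq;
      do !split => //; lra.
  have a1 := Hq (x, y); have a2 := Hq (x + w', y).
  have a3 := Hq (x, y + h'); have a4 := Hq (x + w', y + h').
  move: a1 a2 a3 a4 bJ => /=.
  have -> : J x (x + 2 * w') y (y + 2 * h') =
      J x (x + w') y (y + h') + J (x + w') (x + w' + w') y (y + h') +
      J x (x + w') (y + h') (y + h' + h') +
      J (x + w') (x + w' + w') (y + h') (y + h' + h').
    by rewrite -!addrA -!mulr2n !mulr_natl /J; ring.
  set j1 := J x _ y _; set j2 := J (x + w') _ y _.
  set j3 := J x _ (y + h') _; set j4 := J (x + w') _ (y + h') _.
  have k1 := ler_normD (j1 + j2 + j3) j4.
  have k2 := ler_normD (j1 + j2) j3.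
  have k3 := ler_normD j1 j2.
  rewrite exprS; set t := 4 ^+ n => a1 a2 a3 a4 bJ.
  have t0 : 0 < t by rewrite exprn_gt0.
  have k4 : t * `|j1 + j2 + j3 + j4| <= t * (`|j1| + `|j2| + `|j3| + `|j4|).
    by rewrite ler_pM2l//; lra.
  have {}a1 : 4 * t * `|j1| < e0 by apply: a1; clear -w'0 h'0; lra.
  have {}a2 : 4 * t * `|j2| < e0 by apply: a2; clear -w'0 h'0; lra.
  have {}a3 : 4 * t * `|j3| < e0 by apply: a3; clear -w'0 h'0; lra.
  have {}a4 : 4 * t * `|j4| < e0 by apply: a4; clear -w'0 h'0; lra.
  lra.
have [F FP] := choice step.
pose s := fix s n := if n is m.+1 then F (m, s m) else (x1, y1).
have bads n : bad n (s n).
  elim: n => [|n IH]; last by have [] := FP (n, s n) IH.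
  by rewrite /bad /w /h /= !expr0 !divr1 mul1r !(addrC _ (_ - _)) !subrK.
have subs n : sub n (s n) (s n.+1) by have [] := FP (n, s n) (bads n).
have [x0 Hx0] : exists x0, forall n, (s n).1 <= x0 <= (s n).1 + w n.
  apply: nested_intervals => [||n]; last by rewrite lerDl.
  - by apply/nondecreasing_seqP => n; have [] := subs n.
  - by apply/nonincreasing_seqP => n; have [] := subs n.
have [y0 Hy0] : exists y0, forall n, (s n).2 <= y0 <= (s n).2 + h n.
  apply: nested_intervals => [||n]; last by rewrite lerDl.
  - by apply/nondecreasing_seqP => n; have [] := subs n.
  - by apply/nonincreasing_seqP => n; have [] := subs n.
have R0 : in_rect x1 x2 y1 y2 x0 y0.
  have := Hx0 0%N; have := Hy0 0%N; have [] := bads 0%N => /= *.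
  by split; lra.
(* Multiplied by [4 ^+ n], the estimate [2 * e * (w n + h n) ^+ 2] equals [e * K] for every [n]; the
   choice [e = e0 / (K + 1)] makes this less than [e0]. *)
pose K := 2 * ((x2 - x1) + (y2 - y1)) ^+ 2.
have K0 : 0 <= K by rewrite mulr_ge0// sqr_ge0.
have e1_gt0 : 0 < e0 / (K + 1) by rewrite divr_gt0// ltr_wpDl.
have [delta d0 Hd] := circulation_small prim (cl _ _ R0) e1_gt0.
have [n nd] := exists_small_halves ((x2 - x1) + (y2 - y1)) d0.
have whn : w n + h n < delta by rewrite /w /h -mulrDl.
have := w_ge0 n; have := h_ge0 n => hn wn.
have [b1 b2 b3 b4 b5] := bads n.
have := Hd (s n).1 (s n).2 (w n) (h n); rewrite wn hn /= => H.
have {H} := H _ _ b1 b2 b3 b4 (Hx0 n) (Hy0 n).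
have -> : w n < delta by lra.
have -> : h n < delta by lra.
move=> /(_ isT isT) Jn.
have : e0 <= 4 ^+ n * (2 * (e0 / (K + 1)) * (w n + h n) ^+ 2).
  by apply: le_trans b5 _; rewrite ler_pM2l// exprn_gt0.
have -> : 4 ^+ n * (2 * (e0 / (K + 1)) * (w n + h n) ^+ 2) = e0 / (K + 1) * K.
  rewrite /w /h -mulrDl expr_div_n -exprM mulnC exprM.
  have -> : 2 ^+ 2 = 4 :> R by ring.
  rewrite /K; field.
  by rewrite expf_neq0//= gt_eqF// ltr_wpDl.
rewrite leNgt => /negP; apply.
by rewrite mulrAC ltr_pdivrMr ?ltr_wpDl// ltr_pM2l// ltrDl.
Qed.

End Goursat.

(** * Circulation around a singular point *)

Section Residue.
Variable R : realType.
Implicit Types (phi Phi : R -> R).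

Definition itv_continuous (a b : R) phi := forall x, a <= x <= b ->
  forall e, 0 < e -> exists2 delta, 0 < delta & forall y, a <= y <= b ->
    `|y - x| < delta -> `|phi y - phi x| < e.

(** Composing with the 1-Lipschitz retraction [cl] onto the segment makes [phi] continuous on the
    whole line, so that the endpoints get two-sided derivatives as well. *)
Lemma itv_primitive (a b : R) phi : a <= b -> itv_continuous a b phi ->
  exists Phi, forall x, a <= x <= b -> is_derive x 1 Phi (phi x).
Proof.
move=> ab cphi.
pose cl x := Num.max a (Num.min b x).
have cl_itv x : a <= cl x <= b.
  by rewrite /cl le_max lexx ge_max ab ge_min lexx.
have cl_id x : a <= x <= b -> cl x = x.
  by move=> /andP[ax xb]; rewrite /cl (min_idPr xb) (max_idPr ax).
have cl_mono x y : x <= y -> 0 <= cl y - cl x <= y - x.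
  rewrite /cl => xy; apply/andP.
  case: (leP b x) => bx; case: (leP b y) => by_;
    case: (leP a x) => ax; case: (leP a y) => ay;
    case: (leP a b) => ab'; split; lra.
have cl_lip x y : `|cl y - cl x| <= `|y - x|.
  case/orP: (le_total x y) => /[dup] xy /cl_mono /andP[h1 h2].
    by rewrite !ger0_norm ?subr_ge0//; lra.
  by rewrite distrC [leRHS]distrC !ger0_norm ?subr_ge0//; lra.
have [Phi HPhi] : exists Phi, forall x, a <= x <= b ->
    is_derive x 1 Phi ((phi \o cl) x).
  apply: exists_primitive => x; apply/cvgrPdist_lt => e e0.
  have [d d0 Hd] := cphi (cl x) (cl_itv x) e e0.
  near=> y; rewrite distrC; apply: Hd; first exact: cl_itv.
  apply: le_lt_trans (cl_lip _ _) _; rewrite distrC.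
  by near: y; exact: cvgr_dist_lt.
by exists Phi => x xab; have := HPhi x xab; rewrite /= cl_id.
Unshelve. all: by end_near. Qed.

(** Serves the lines that cross the excluded square. The constants on the two sides are unrelated,
    which is harmless: only increments within one side are ever taken. *)
Lemma gap_primitive (r s : R) phi : 0 < s -> s <= r ->
  itv_continuous (- r) (- s) phi -> itv_continuous s r phi ->
  exists Phi, forall x : R, s <= `|x| <= r -> is_derive x 1 Phi (phi x).
Proof.
move=> s0 sr /itv_primitive[|F HF]; first by rewrite lerN2.
move=> /(itv_primitive sr)[G HG].
exists (fun x => if x < 0 then F x else G x) => x.
case: (ltP x 0) => x0.
- rewrite ltr0_norm// => H; have {}/HF HF : - r <= x <= - s by lra.
  apply: (near_eq_is_derive _ HF).
  by near=> y; rewrite ifT//; near: y; exact: lt_nbhsl.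
- rewrite ger0_norm// => /[dup] H /HG {}HG.
  apply: (near_eq_is_derive _ HG).
  near=> y; rewrite ifF//; apply/negbTE; rewrite -leNgt -oppr_le0 ltW//.
  by near: y; apply: Nlt_nbhsl; lra.
Unshelve. all: by end_near. Qed.

Lemma closed_form_itv_continuous (A B : R -> R -> R) (x1 x2 y1 y2 : R) :
  (forall y a b, x1 <= a -> b <= x2 -> y1 <= y <= y2 ->
    (forall x, a <= x <= b -> closed_form_at A B x1 x2 y1 y2 x y) ->
    itv_continuous a b (A^~ y)) /\
  (forall x a b, y1 <= a -> b <= y2 -> x1 <= x <= x2 ->
    (forall y, a <= y <= b -> closed_form_at A B x1 x2 y1 y2 x y) ->
    itv_continuous a b (B x)).
Proof.
have key (a b d e : R) : 0 < e -> `|d| < e / (2 * (`|a| + 1)) ->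
    `|b - a * d| <= 1 * `|d| -> `|b| < e.
  move=> e0; rewrite ltr_pdivlMr; last by rewrite mulr_gt0// ltr_wpDl.
  move=> de; rewrite mul1r => H.
  have := ler_normD (b - a * d) (a * d); rewrite subrK normrM.
  by have := normr_ge0 d; nra.
split.
- move=> y a b x1a bx2 yy cl x xab e e0.
  have [c [c' [c'' /(_ 1 ltr01)[d d0 Hd]]]] := cl x xab.
  exists (Num.min d (e / (2 * (`|c| + 1)))).
    by rewrite lt_min d0 divr_gt0// mulr_gt0// ltr_wpDl.
  move=> x' x'ab; rewrite lt_min => /andP[xd xe].
  have Rx : in_rect x1 x2 y1 y2 x' y by split=> //; lra.
  have := Hd x' y Rx xd; rewrite subrr normr0 => /(_ d0)[+ _].
  rewrite mulr0 !addr0 opprD addrA => H.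
  exact: key e0 xe H.
- move=> x a b y1a by2 xx cl y yab e e0.
  have [c'' [c' [c /(_ 1 ltr01)[d d0 Hd]]]] := cl y yab.
  exists (Num.min d (e / (2 * (`|c| + 1)))).
    by rewrite lt_min d0 divr_gt0// mulr_gt0// ltr_wpDl.
  move=> y' y'ab; rewrite lt_min => /andP[yd ye].
  have Rx : in_rect x1 x2 y1 y2 x y' by split=> //; lra.
  have := Hd x y' Rx; rewrite subrr normr0 => /(_ d0 yd)[_ +].
  rewrite mulr0 addr0 add0r opprD addrA => H.
  exact: key e0 ye H.
Qed.

(* The integral along the boundary of [-r, r]^2 equals the one along arbitrarily
   small squares around 0, hence vanishes. *)
Lemma no_positive_circulation (A B : R -> R -> R) (r eta : R) :
  0 < r -> 0 < eta ->
  (forall x y, in_rect (- r) r (- r) r x y -> (x != 0) || (y != 0) ->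
    closed_form_at A B (- r) r (- r) r x y) ->
  (forall e, 0 < e -> exists2 s, 0 < s <= r & forall x y,
    in_rect (- s) s (- s) s x y -> `|x| = s \/ `|y| = s ->
    `|A x y| * s <= e /\ `|B x y| * s <= e) ->
  (forall t, - r <= t <= r ->
    [/\ eta <= A t (- r), A t r <= - eta, eta <= B r t & B (- r) t <= - eta]) ->
  False.
Proof.
move=> r0 eta0 cl small bnd.
(* On the small square the form is then at most [eta * r / (2 * s)], so each of its edges, of length
   [2 * s], contributes at most [eta * r]. Each outer edge contributes at least [2 * eta * r]. *)
have [|s /andP[s0 sr] Hs] := small (eta * r / 2);
  first by rewrite divr_gt0// mulr_gt0.
have smr : - r <= s <= r by lra.
have smr' : - r <= - s <= r by lra.
have ss : - s <= s by lra.
have str (t : R) : - s <= t <= s -> - r <= t <= r by lra.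
have tss (t : R) : t = s \/ t = - s -> - s <= t <= s.
  by case=> ->; rewrite lexx ss.
have cl' x y : - r <= x <= r -> - r <= y <= r -> (s <= `|x|) || (s <= `|y|) ->
    closed_form_at A B (- r) r (- r) r x y.
  move=> xr yr H; apply: cl => //; rewrite -!normr_gt0.
  by case/orP: H => H; apply/orP; [left|right]; exact: lt_le_trans H.
have [cA cB] := closed_form_itv_continuous A B (- r) r (- r) r.
have absP (t : R) : - r <= t <= - s \/ s <= t <= r ->
    s <= `|t| /\ - r <= t <= r.
  move=> [] H; split; try lra; first by rewrite ler0_norm; lra.
  by rewrite ger0_norm; lra.
have absPl (t : R) : - r <= t <= - s -> s <= `|t| /\ - r <= t <= r.
  by move=> H; apply: absP; left.
have absPr (t : R) : s <= t <= r -> s <= `|t| /\ - r <= t <= r.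
  by move=> H; apply: absP; right.
have /choice[U HU] : forall y, exists F : R -> R, - r <= y <= r -> forall x : R,
    - r <= x <= r -> (s <= `|x|) || (s <= `|y|) -> is_derive x 1 F (A x y).
  move=> y; case: (pselect (- r <= y <= r)) => yr; last by exists id.
  have [ys|ys] := lerP s `|y|.
    have [||F HF] := @itv_primitive (- r) r (A^~ y); [lra| |].
      by apply: cA => // x xr; apply: cl' => //; rewrite ys orbT.
    by exists F => _ x xr _; apply: HF.
  have [||F HF] := @gap_primitive r s (A^~ y) s0 sr.
  - apply: cA => //; first by lra.
    by move=> x /absPl[? ?]; apply: cl' => //; apply/orP; left.
  - apply: cA => //; first by lra.
    by move=> x /absPr[? ?]; apply: cl' => //; apply/orP; left.
  exists F => _ x xr; rewrite orbF => xs; apply: HF; rewrite xs /=.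
  by rewrite ler_norml.
have /choice[V HV] : forall x, exists F : R -> R, - r <= x <= r -> forall y : R,
    - r <= y <= r -> (s <= `|x|) || (s <= `|y|) -> is_derive y 1 F (B x y).
  move=> x; case: (pselect (- r <= x <= r)) => xr; last by exists id.
  have [xs|xs] := lerP s `|x|.
    have [||F HF] := @itv_primitive (- r) r (B x); [lra| |].
      by apply: cB => // y yr; apply: cl' => //; rewrite xs.
    by exists F => _ y yr _; apply: HF.
  have [||F HF] := @gap_primitive r s (B x) s0 sr.
  - apply: cB => //; first by lra.
    by move=> y /absPl[? ?]; apply: cl' => //; apply/orP; right.
  - apply: cB => //; first by lra.
    by move=> y /absPr[? ?]; apply: cl' => //; apply/orP; right.
  exists F => _ y yr /= ys; apply: HF; rewrite ys /=.
  by rewrite ler_norml.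
pose J := rect_circulation (fun x y => U y x) V.
have J0 x1 x2 y1 y2 : - r <= x1 <= x2 -> x2 <= r -> - r <= y1 <= y2 -> y2 <= r
  ->
    (forall x y, in_rect x1 x2 y1 y2 x y -> (s <= `|x|) || (s <= `|y|)) ->
    J x1 x2 y1 y2 = 0.
  move=> /andP[? ?] ? /andP[? ?] ? away.
  apply: (@goursat_rectangle R A B) => //.
    move=> x y /[dup] /away sxy [/andP[? ?] /andP[? ?]].
    by split; [apply: HU => //; lra|apply: HV => //; lra].
  move=> x y /[dup] /away sxy [/andP[? ?] /andP[? ?]].
  have [||a [b [c Habc]]] := cl' x y _ _ sxy; [lra|lra|].
  exists a, b, c => e /Habc[d d0 Hd];
    exists d => // x' y' [/andP[? ?] /andP[? ?]].
  by apply: Hd; split; lra.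
(* The four rectangles tile the frame between the two squares: two full columns, and the pieces
   below and above the small square. Adding them equates the outer and the inner circulation. *)
have H1 : J (- r) (- s) (- r) r = 0.
  apply: J0; try lra; move=> x y [+ _] => /absPl[-> _] //.
have H2 : J s r (- r) r = 0.
  apply: J0; try lra; move=> x y [+ _] => /absPr[-> _] //.
have H3 : J (- s) s (- r) (- s) = 0.
  apply: J0; try lra.
  by move=> x y [_ +] => /absPl[-> _]; rewrite orbT.
have H4 : J (- s) s s r = 0.
  apply: J0; try lra.
  by move=> x y [_ +] => /absPr[-> _]; rewrite orbT.
have rr : - r <= r by lra.
have rr1 : - r <= - r <= r by lra.
have rr2 : - r <= r <= r by lra.
have sx (x : R) : (s <= `|r|) * (s <= `|- r|).
  by rewrite normrN gtr0_norm.
have dU y x : - r <= y <= r -> - r <= x <= r -> s <= `|y| ->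
    is_derive x 1 (U y) (A x y) by move=> ? ? sy; apply: HU; rewrite ?sy ?orbT.
have dV x y : - r <= x <= r -> - r <= y <= r -> s <= `|x| ->
    is_derive y 1 (V x) (B x y) by move=> ? ? sy; apply: HV; rewrite ?sy ?orbT.
have sr1 : s <= `|r| by rewrite gtr0_norm.
have sr2 : s <= `|- r| by rewrite normrN.
have ss1 : s <= `|s| by rewrite gtr0_norm.
have ss2 : s <= `|- s| by rewrite normrN.
have K1 : eta * (r - - r) <= U (- r) r - U (- r) (- r).
  by apply: derive_ge_increment => // x xr; [exact: dU|have [] := bnd x xr].
have K2 : U r r - U r (- r) <= - eta * (r - - r).
  by apply: derive_le_increment => // x xr; [exact: dU|have [] := bnd x xr].
have K3 : eta * (r - - r) <= V r r - V r (- r).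
  by apply: derive_ge_increment => // x xr; [exact: dV|have [] := bnd x xr].
have K4 : V (- r) r - V (- r) (- r) <= - eta * (r - - r).
  by apply: derive_le_increment => // x xr; [exact: dV|have [] := bnd x xr].
have smallA x y : in_rect (- s) s (- s) s x y -> `|x| = s \/ `|y| = s ->
    `|A x y| <= eta * r / 2 / s /\ `|B x y| <= eta * r / 2 / s.
  by move=> Rxy xys; have [? ?] := Hs x y Rxy xys; split; rewrite ler_pdivlMr.
have L t : t = s \/ t = - s -> `|U t s - U t (- s)| <= eta * r / 2 / s * (s -
  - s).
  move=> ts; have [t1 t2] : s <= `|t| /\ - r <= t <= r by case: ts => ->; split.
  apply: (derive_norm_increment ss (phi := A^~ t)) => x xs.
    by apply: dU => //; exact: str.
  have [|//|//] := smallA x t.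
    by split=> //; exact: tss.
  by right; case: ts => ->; rewrite ?normrN gtr0_norm.
have L' t : t = s \/ t = - s -> `|V t s - V t (- s)| <= eta * r / 2 / s * (s -
  - s).
  move=> ts; have [t1 t2] : s <= `|t| /\ - r <= t <= r by case: ts => ->; split.
  apply: (derive_norm_increment ss (phi := B t)) => x xs.
    by apply: dV => //; exact: str.
  have [|//|//] := smallA t x.
    by split=> //; exact: tss.
  by left; case: ts => ->; rewrite ?normrN gtr0_norm.
have {}L t : t = s \/ t = - s -> `|U t s - U t (- s)| <= eta * r.
  by move=> /L /le_trans; apply; rewrite opprK -mulr2n -mulr_natr; apply: eqW;
    field; exact: lt0r_neq0.
have {}L' t : t = s \/ t = - s -> `|V t s - V t (- s)| <= eta * r.
  by move=> /L' /le_trans; apply; rewrite opprK -mulr2n -mulr_natr;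
    apply: eqW; field; exact: lt0r_neq0.
have := L s (or_introl erefl); have := L (- s) (or_intror erefl).
have := L' s (or_introl erefl); have := L' (- s) (or_intror erefl).
have er : 0 < eta * r by rewrite mulr_gt0.
move: H1 H2 H3 H4 K1 K2 K3 K4; clear -er.
rewrite !ler_norml /J /rect_circulation.
move=> ? ? ? ? ? ? ? ? /andP[? ?] /andP[? ?] /andP[? ?] /andP[? ?]; lra.
Qed.

End Residue.

(** * The Cauchy estimate *)

Lemma differentiable_expansion (K : numFieldType) (V W : normedModType K)
    (u : V -> W) (x : V) : differentiable u x ->
  forall e, 0 < e -> exists2 delta, 0 < delta & forall h, `|h| < delta ->
    `|u (x + h) - u x - 'd u x h| <= e * `|h|.
Proof.
move=> /diff_locally /eqaddoP H e e0; have := H e e0.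
move=> /nbhs_norm0P[d /= d0 Hd]; exists d => // h hd.
have := Hd h hd; rewrite /= !fctE opprD addrA [h + x]addrC.
by rewrite /cst.
Qed.

Lemma expansion_differentiable (K : numFieldType) (V W : normedModType K)
    (u : V -> W) (x : V) (L : {linear V -> W}) : continuous L ->
  (forall e, 0 < e -> exists2 delta, 0 < delta & forall h, `|h| < delta ->
    `|u (x + h) - u x - L h| <= e * `|h|) ->
  differentiable u x /\ 'd u x = L :> (V -> W).
Proof.
move=> Lc H.
have E : u \o shift x = cst (u x) + L +o_ 0 id.
  apply/eqaddoP => e e0; have [d d0 Hd] := H e e0.
  apply/nbhs_norm0P; exists d => // h /= hd.
  by have := Hd h hd; rewrite !fctE opprD addrA [h + x]addrC.
have dE : 'd u x = L :> (V -> W) by exact: diff_unique.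
split=> //; apply/diff_locallyP; split; first by rewrite dE.
by rewrite dE.
Qed.

Section CauchyEstimate.
Local Open Scope complex_scope.
Variable R : realType.
Local Notation C := (Cplx R).
Local Notation normc := (@Normc.normc R).
Local Notation Re := (@complex.Re R).
Local Notation Im := (@complex.Im R).

Lemma Cplx_normE (z : C) : `|z| = (normc z)%:C :> C.
Proof. by []. Qed.

Lemma Cplx_gt0P (d : C) : 0 < d -> exists2 r : R, 0 < r & d = r%:C.
Proof.
case: d => a b; rewrite ltcE /= => /andP[/eqP -> a0]; by exists a.
Qed.

Lemma Cplx_derivable_expansion (H : C -> C) (z : C) : derivable H z 1 ->
  forall e : R, 0 < e -> exists2 delta : R, 0 < delta & forall w : C,
    normc (w - z) < delta ->
    normc (H w - H z - (w - z) * 'D_1 H z) <= e * normc (w - z).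
Proof.
move=> dH e e0; have /derivable1_diffP dH' := dH.
have [|d d0 Hd] := differentiable_expansion dH' (e := e%:C);
  first by rewrite ltcR.
have [d' d'0 dd'] := Cplx_gt0P d0; exists d' => // w.
rewrite -ltcR -Cplx_normE -dd' => /Hd.
rewrite [z + _]addrC subrK => {}Hd.
rewrite -lecR rmorphM /= -!Cplx_normE; apply: le_trans Hd.
apply: eqW; congr (`|_ - _|).
by rewrite -derive1E deriv1E.
Qed.

Lemma normc_ge0 (z : C) : 0 <= normc z.
Proof. by case: z => x y; exact: sqrtr_ge0. Qed.

Lemma normc_geRe (z : C) : `|Re z| <= normc z.
Proof.
by case: z => x y /=; rewrite -sqrtr_sqr ler_sqrt ?lerDl ?addr_ge0 ?sqr_ge0.
Qed.

Lemma normc_geIm (z : C) : `|Im z| <= normc z.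
Proof.
by case: z => x y /=; rewrite -sqrtr_sqr ler_sqrt ?lerDr ?addr_ge0 ?sqr_ge0.
Qed.

Lemma normc_leD (z : C) : normc z <= `|Re z| + `|Im z|.
Proof.
case: z => x y /=.
have -> : `|x| + `|y| = Num.sqrt ((`|x| + `|y|) ^+ 2).
  by rewrite sqrtr_sqr [RHS]ger0_norm ?addr_ge0.
rewrite ler_sqrt ?sqr_ge0// sqrrD !real_normK ?num_real//.
by rewrite addrAC lerDl mulrn_wge0// mulr_ge0.
Qed.

(** The form is [Im (H dz) = Im H dx + Re H dy]. With [c] the complex derivative, the Cauchy-Riemann
    equations appear as the shared coefficient [Re c]. *)
Lemma Cplx_derivable_closed_form (H : C -> C) (x1 x2 y1 y2 x0 y0 : R) :
  derivable H (x0 +i* y0) 1 ->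
  closed_form_at (fun x y => Im (H (x +i* y))) (fun x y => Re (H (x +i* y)))
    x1 x2 y1 y2 x0 y0.
Proof.
move=> /Cplx_derivable_expansion; set c := 'D_1 H _ => Hexp.
exists (Im c), (Re c), (- Im c) => e e0; have [d d0 Hd] := Hexp e e0.
exists (d / 2); first by rewrite divr_gt0.
move=> x y _ xd yd.
have n1 : normc ((x +i* y : C) - (x0 +i* y0)) <= `|x - x0| + `|y - y0|.
  exact: le_trans (normc_leD _) _.
have {}Hd : normc (H (x +i* y) - H (x0 +i* y0) -
    ((x +i* y : C) - (x0 +i* y0)) * c) <= e * (`|x - x0| + `|y - y0|).
  apply: le_trans (Hd _ _) _; first by apply: le_lt_trans n1 _; lra.
  by rewrite ler_pM2l.
split.
- apply: le_trans _ Hd; apply: le_trans _ (normc_geIm _); clear Hexp.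
  move: c (H (x +i* y)) (H (x0 +i* y0)) => [a b] [u v] [u' v'] /=.
  by apply: eqW; congr (`|_|); ring.
- apply: le_trans _ Hd; apply: le_trans _ (normc_geRe _); clear Hexp.
  move: c (H (x +i* y)) (H (x0 +i* y0)) => [a b] [u v] [u' v'] /=.
  by apply: eqW; congr (`|_|); ring.
Qed.

Lemma cauchy_estimate_normalised (G : C -> C) (r M : R) : 0 < r ->
  (forall z : C, `|Re z| <= r -> `|Im z| <= r -> derivable G z 1) ->
  (forall z : C, `|Re z| <= r -> `|Im z| <= r -> normc (G z) <= M) ->
  'D_1 G 0 = - 1 -> r / 4 <= M.
Proof.
move=> r0 dG GM dG0; rewrite leNgt; apply/negP => Mr.
pose H (z : C) : C := (G z - G 0 + z) / z ^+ 2.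
pose A x y := Im (H (x +i* y)); pose B x y := Re (H (x +i* y)).
have G0M : normc (G 0) <= M by apply: GM => /=; rewrite normr0 ltW.
have M0 : 0 <= M by apply: le_trans _ G0M; exact: normc_ge0.
have Hinv (z : C) : `|Re z| <= r -> `|Im z| <= r -> r <= normc z ->
    normc (H z - z^-1) <= 2 * M / r ^+ 2.
  move=> zr zi rz.
  have nz : normc z != 0 by rewrite gt_eqF// (lt_le_trans r0).
  have z0 : z != 0 by apply: contra nz => /eqP ->; rewrite Normc.normc0.
  have -> : H z - z^-1 = (G z - G 0) / z ^+ 2 by rewrite /H; field.
  rewrite Normc.normcM Normc.normcV expr2 Normc.normcM.
  apply: ler_pM; rewrite ?normc_ge0 ?invr_ge0 ?mulr_ge0 ?normc_ge0//.
    apply: le_trans (le_normcD _ _) _; rewrite normcN.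
    have := GM z zr zi; lra.
  rewrite lef_pV2 ?posrE ?exprn_gt0//;
    last by rewrite mulr_gt0// (lt_le_trans r0).
  by rewrite expr2 ler_pM// ltW.
(* On each edge [1 / z] contributes at least [1 / (2 * r)] with the right sign, and [H - 1 / z] at
   most [2 * M / r ^+ 2]. The difference is positive exactly when [M < r / 4]. *)
pose eta := (2 * r)^-1 - 2 * M / r ^+ 2.
have eta0 : 0 < eta.
  rewrite /eta subr_gt0 ltr_pdivrMr ?exprn_gt0//.
  have -> : (2 * r)^-1 * r ^+ 2 = r / 2 by field; exact: lt0r_neq0.
  lra.
have rn (t : R) : - r <= t <= r -> `|t| <= r by rewrite ler_norml.
apply: (@no_positive_circulation R A B r eta r0 eta0).
- move=> x y [/rn xr /rn yr] xy0; apply: Cplx_derivable_closed_form.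
  have z0 : (x +i* y : C) != 0.
    by apply/negP => /eqP[x0 y0]; rewrite x0 y0 eqxx in xy0.
  apply: derivableM; last first.
    apply: derivableV; first by rewrite expf_neq0.
    exact: exprn_derivable.
  apply: derivableD; last exact: derivable_id.
  by apply: derivableB; [exact: dG|exact: derivable_cst].
(* Since [G] has derivative -1 at 0, the numerator of [H] is at most [e * normc z] near 0; dividing
   by [z ^+ 2] and using [s <= normc z] gives [normc (H z) * s <= e]. *)
- move=> e e0; have dG00 : derivable G 0 1 by apply: dG; rewrite /= normr0 ltW.
  have [d d0 Hd] := Cplx_derivable_expansion dG00 e0.
  exists (Num.min r (d / 3)); first by rewrite lt_min r0 ge_min lexx divr_gt0.
  set s := Num.min _ _ => x y [/andP[xs1 xs2] /andP[ys1 ys2]] bd.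
  have s0 : 0 < s by rewrite /s lt_min r0 divr_gt0.
  have sd : s <= d / 3 by rewrite /s ge_min lexx orbT.
  pose z : C := x +i* y.
  have sz : s <= normc z.
    case: bd => <-; [exact: (normc_geRe z)|exact: (normc_geIm z)].
  have zd : normc (z - 0) < d.
    rewrite subr0; apply: le_lt_trans (normc_leD z) _ => /=.
    have : `|x| <= s by rewrite ler_norml xs1.
    have : `|y| <= s by rewrite ler_norml ys1.
    lra.
  have := Hd z zd; rewrite dG0 mulrN1 opprK subr0 => Ez.
  have nz : 0 < normc z by exact: lt_le_trans sz.
  suff HzE : normc (H z) * s <= e.
    by split; apply: le_trans _ HzE; rewrite ler_pM2r//;
      [exact: (normc_geIm (H z))|exact: (normc_geRe (H z))].
  rewrite /H Normc.normcM Normc.normcV expr2 Normc.normcM -mulrA.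
  apply: le_trans (ler_wpM2r _ Ez) _.
    by rewrite mulr_ge0 ?invr_ge0 ?mulr_ge0 ?normc_ge0// ltW.
  have -> : e * normc z * ((normc z * normc z)^-1 * s) = e * (s / normc z).
    by field; exact: lt0r_neq0.
  by rewrite ger_pMr// ler_pdivrMr// mul1r.
- move=> t tr.
  (* These are the imaginary and real parts of [1 / z], whose signs on the four edges match the
     orientation. *)
  have key (x y : R) : `|x| <= r -> `|y| <= r -> `|x| = r \/ `|y| = r ->
      `|A x y - - y / (x ^+ 2 + y ^+ 2)| <= 2 * M / r ^+ 2 /\
      `|B x y - x / (x ^+ 2 + y ^+ 2)| <= 2 * M / r ^+ 2.
    move=> xr yr bd; have rz : r <= normc (x +i* y : C).
      case: bd => <-.
        exact: (normc_geRe (x +i* y)).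
      exact: (normc_geIm (x +i* y)).
    have := Hinv (x +i* y) xr yr rz => Hz.
    split; apply: le_trans _ Hz.
      by apply: le_trans _ (normc_geIm _); rewrite /A; case: (H _) => u v /=;
        rewrite mulNr.
    by apply: le_trans _ (normc_geRe _); rewrite /B; case: (H _) => u v /=.
  have t2 : 1 / (2 * r) <= r / (t ^+ 2 + r ^+ 2).
    rewrite ler_pdivrMr ?mulr_gt0// mulrAC ler_pdivlMr; last first.
      by rewrite ltr_wpDl ?sqr_ge0// exprn_gt0.
    have : 0 <= (r - t) * (r + t) by have /andP[? ?] := tr; apply: mulr_ge0;
      lra.
    by lra.
  have rr : `|r| = r by rewrite gtr0_norm.
  have rr' : `|- r| = r by rewrite normrN.
  have tr' := rn t tr.
  have [] := key t (- r) tr' _ (or_intror rr'); first by rewrite rr'.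
  have [] := key t r tr' _ (or_intror rr); first by rewrite rr.
  have [] := key r t _ tr' (or_introl rr); first by rewrite rr.
  have [] := key (- r) t _ tr' (or_introl rr'); first by rewrite rr'.
  rewrite sqrrN opprK [r ^+ 2 + t ^+ 2]addrC !mulNr !ler_norml.
  move: (t ^+ 2 + r ^+ 2) t2 => q; rewrite /eta div1r;
    move: (2 * M / r ^+ 2) => m t2.
  move=> _ /andP[? ?] _ /andP[? ?] /andP[? ?] _ /andP[? ?] _.
  by split; lra.
Qed.

Lemma cauchy_estimate0 (G : C -> C) (r M : R) : 0 < r ->
  (forall z : C, `|Re z| <= r -> `|Im z| <= r -> derivable G z 1) ->
  (forall z : C, `|Re z| <= r -> `|Im z| <= r -> normc (G z) <= M) ->
  normc ('D_1 G 0) <= 4 * M / r.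
Proof.
move=> r0 dG GM; set c := 'D_1 G 0.
have M0 : 0 <= M by apply: le_trans (normc_ge0 _) (GM 0 _ _);
  rewrite /= normr0 ltW.
have [->|c0] := eqVneq c 0.
  by rewrite Normc.normc0 divr_ge0// ?mulr_ge0// ltW.
have nc : 0 < normc c.
  by rewrite lt_def normc_ge0 andbT;
    apply: contra c0 => /eqP/Normc.eq0_normc ->.
have dG0 : derivable G 0 1 by apply: dG; rewrite /= normr0 ltW.
have := @cauchy_estimate_normalised (fun z => - c^-1 * G z) r (M / normc c) r0.
move=> H; have {H} := H _ _ _.
rewrite ler_pdivlMr// => H.
rewrite ler_pdivlMr//.
have : r / 4 * normc c <= M.
  apply: H.
  - by move=> z z1 z2; apply: derivableM; [exact: derivable_cst|exact: dG].
  - move=> z z1 z2; rewrite Normc.normcM normcN Normc.normcV mulrC.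
    by rewrite ler_pM2r ?invr_gt0//; exact: GM.
  - by rewrite deriveMl// -/c mulNr mulVf.
lra.
Qed.

End CauchyEstimate.

(** * Estimates in normed modules over the complex field *)

Section RealNorm.
Local Open Scope complex_scope.
Variable R : realType.
Local Notation C := (Cplx R).
Local Notation normc := (@Normc.normc R).
Local Notation Re := (@complex.Re R).
Local Notation Im := (@complex.Im R).

(* Norms over the complex field are complex numbers; their real part makes them
   available to real arithmetic. *)
Definition nrm (V : normedModType C) (v : V) : R := Re `|v|.

Variable V : normedModType C.
Implicit Types (u v h k : V) (a : C).

Lemma nrmE v : `|v| = (nrm v)%:C :> C.
Proof. by rewrite /nrm RRe_real// normr_real. Qed.

Lemma nrm_ge0 v : 0 <= nrm v.
Proof. by rewrite -ler0c -nrmE normr_ge0. Qed.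

Lemma nrmD u v : nrm (u + v) <= nrm u + nrm v.
Proof. by rewrite -lecR rmorphD /= -!nrmE ler_normD. Qed.

Lemma nrm0 : nrm (0 : V) = 0.
Proof. by rewrite /nrm normr0. Qed.

Lemma nrm_eq0 v : (nrm v == 0) = (v == 0).
Proof. by rewrite -(normr_eq0 v) nrmE; apply/eqP/eqP => [->//|[]]. Qed.

Lemma nrmZ a v : nrm (a *: v) = normc a * nrm v.
Proof.
by apply: (@complexI R); rewrite rmorphM /= -nrmE -Cplx_normE normrZ -nrmE.
Qed.

Lemma nrm_Cplx (a : C) : nrm a = normc a.
Proof. by rewrite /nrm Cplx_normE. Qed.

Lemma normc_real (t : R) : normc t%:C = `|t|.
Proof. by rewrite /= expr0n /= addr0 sqrtr_sqr. Qed.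

End RealNorm.

Section NrmDifferentiable.
Local Open Scope complex_scope.
Variables (R : realType).
Local Notation C := (Cplx R).
Variables (V W : normedModType C).

Lemma differentiable_nrm (u : V -> W) (x : V) :
  differentiable u x -> forall e : R, 0 < e -> exists2 delta : R, 0 < delta &
    forall h : V, nrm h < delta ->
      nrm (u (x + h) - u x - 'd u x h) <= e * nrm h.
Proof.
move=> /differentiable_expansion H e e0.
have [|d d0 Hd] := H e%:C; first by rewrite ltcR.
have [d' d'0 dd'] := Cplx_gt0P d0; exists d' => // h.
rewrite -ltcR -nrmE -dd' => /Hd.
by rewrite !nrmE -rmorphM /= lecR.
Qed.

Lemma nrm_differentiable (u : V -> W) (x : V)
    (L : {linear V -> W}) (K : R) : (forall h, nrm (L h) <= K * nrm h) ->
  (forall e : R, 0 < e -> exists2 delta : R, 0 < delta &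
    forall h : V, nrm h < delta ->
    nrm (u (x + h) - u x - L h) <= e * nrm h) ->
  differentiable u x.
Proof.
move=> LK H.
have K0 : 0 < Num.max K 1 by rewrite lt_max ltr01 orbT.
have Lc : continuous L.
  apply: bounded_linear_continuous; apply/linear_boundedP.
  exists (Num.max K 1)%:C; split; first by rewrite realE ler0c ltW.
  move=> B KB z.
  rewrite nrmE; apply: (@le_trans _ _ ((Num.max K 1)%:C * `|z|)).
    rewrite nrmE -rmorphM lecR; apply: le_trans (LK z) _.
    by rewrite ler_wpM2r ?nrm_ge0// le_max lexx.
  by rewrite ler_wpM2r// ltW.
have [] // := @expansion_differentiable C V W u x L Lc.
move=> e e0; have [e' e'0 ->] := Cplx_gt0P e0.
have [d d0 Hd] := H e' e'0; exists d%:C; first by rewrite ltcR.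
by move=> h; rewrite !nrmE -rmorphM ltcR lecR => /Hd.
Qed.

End NrmDifferentiable.

Section Lines.
Local Open Scope complex_scope.
Variable R : realType.
Local Notation C := (Cplx R).
Local Notation normc := (@Normc.normc R).
Local Notation Re := (@complex.Re R).
Local Notation Im := (@complex.Im R).

Lemma expansion_is_derive (F : R -> R) (t c : R) :
  (forall e : R, 0 < e -> exists2 delta : R, 0 < delta & forall s : R,
    `|s - t| < delta -> `|F s - F t - (s - t) * c| <= e * `|s - t|) ->
  is_derive t 1 F c.
Proof.
move=> H.
suff lim : h^-1 *: ((F \o shift t) (h *: 1) - F t) @[h --> 0^'] --> c.
  by split; [apply/cvg_ex; exists c|exact: cvg_lim].
apply/cvgrPdist_le => e e0; have [d d0 Hd] := H e e0.
near=> h; have h0 : h != 0 by near: h; exact: nbhs_dnbhs_neq.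
have hd : `|h| < d.
  by near: h; apply: dnbhs0_lt.
have := Hd (h + t); rewrite addrK /GRing.scale /= mulr1 => /(_ hd) {}Hd.
rewrite distrC -(ler_pM2r (x := `|h|)) ?normr_gt0// -normrM.
by apply: le_trans _ Hd; apply: eqW; congr (`|_|); field.
Unshelve. all: by end_near. Qed.

Variable V : normedModType C.

Lemma is_derive_line (u : V -> C) (x h : V) (z : C) :
  differentiable u (x + z *: h) ->
  is_derive z 1 (fun w : C => u (x + w *: h)) ('d u (x + z *: h) h).
Proof.
move=> du; pose l : C -> V := cst x + ( *:%R^~ h).
have dl : is_diff z l (0 + ( *:%R^~ h)) by exact: is_diffD.
have dc : differentiable (u \o l) z by apply: differentiable_comp.
change (is_derive z 1 (u \o l) ('d u (l z) h)).
split; first exact/derivable1_diffP.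
by rewrite deriveE// diff_comp//= diff_val /= add0r scale1r.
Qed.

(** A mean value theorem holds only for real-valued functions; it is applied to the real and
    imaginary parts separately, and adding them costs the factor 2. *)
Lemma mean_value_nrm (u : V -> C) (y h : V) (c : C) (K : R) :
  (forall t : R, 0 <= t <= 1 -> differentiable u (y + t%:C *: h) /\
     normc ('d u (y + t%:C *: h) h - c) <= K) ->
  normc (u (y + h) - u y - c) <= 2 * K.
Proof.
move=> H; pose G (z : C) : C := u (y + z *: h).
have key (p : C -> R) : (forall a b : C, p (a - b) = p a - p b) ->
    (forall (t : R) (a : C), p (t%:C * a) = t * p a) ->
    (forall z, `|p z| <= normc z) -> `|p (u (y + h) - u y - c)| <= K.
  move=> pB pZ pn.
  have := @derive_norm_increment R (fun t => p (G t%:C) - t * p c)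
    (fun t => p ('d u (y + t%:C *: h) h - c)) 0 1 K ler01.
  rewrite subr0 mulr1 mul0r subr0 mul1r /G scale0r addr0 scale1r !pB.
  rewrite [p _ - p c - _]addrAC; apply; last first.
    by move=> t /H[_ Ht]; apply: le_trans (pn _) Ht.
  move=> t t01; have [du _] := H t t01; apply: expansion_is_derive => e e0.
  have dG := is_derive_line du.
  have [d d0 Hd] := Cplx_derivable_expansion (@ex_derive _ _ _ _ _ _ _ dG) e0.
  exists d => // s sd.
  have {Hd} := Hd s%:C; rewrite derive_val -rmorphB normc_real => /(_ sd).
  apply: le_trans; apply: le_trans _ (pn _); rewrite !pB pZ.
  apply: eqW; congr (`|_|); ring.
apply: le_trans (normc_leD _) _; rewrite mulr_natl mulr2n; apply: lerD.
- by apply: key => [[? ?] [? ?]|? [? ?]|z] //=;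
  [rewrite mul0r subr0|exact: normc_geRe].
- by apply: key => [[? ?] [? ?]|? [? ?]|z] //=;
  [rewrite mul0r addr0|exact: normc_geIm].
Qed.

End Lines.

(** * Cauchy bounds for differentials and increments *)

Section HolomorphicEstimates.
Local Open Scope complex_scope.
Variable R : realType.
Local Notation C := (Cplx R).
Local Notation normc := (@Normc.normc R).
Local Notation Re := (@complex.Re R).
Local Notation Im := (@complex.Im R).
Variable V : normedModType C.
Implicit Types (u : V -> C) (x y z h k : V) (s : C) (rho M : R).

Definition bounded_holomorphic u x rho M := forall y, nrm (y - x) < rho ->
  differentiable u y /\ normc (u y) <= M.

Lemma bounded_holomorphic_ge0 u x rho M :
  0 < rho -> bounded_holomorphic u x rho M -> 0 <= M.
Proof.
move=> r0 H; have [|_] := H x; first by rewrite subrr nrm0.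
exact: le_trans (normc_ge0 _).
Qed.

Lemma bounded_holomorphic_sub u x y rho rho' M :
  nrm (y - x) + rho' <= rho -> bounded_holomorphic u x rho M ->
  bounded_holomorphic u y rho' M.
Proof.
move=> yx H z zy; apply: H; rewrite -(subrK y z) -addrA.
apply: le_lt_trans (nrmD _ _) _; lra.
Qed.

Lemma diff_shift u y h : differentiable u (y + h) ->
  is_diff y (fun z => u (z + h)) ('d u (y + h)).
Proof.
move=> du; pose l : V -> V := id + cst h.
have dl : is_diff y l (id + 0) by exact: is_diffD.
have dc : differentiable (u \o l) y by apply: differentiable_comp.
change (is_diff y (u \o l) ('d u (l y))); split=> //.
by rewrite diff_comp// diff_val addr0.
Qed.

Lemma diff_bound u x h rho M : 0 < rho -> bounded_holomorphic u x rho M ->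
  normc ('d u x h) <= 16 * M / rho * nrm h.
Proof.
move=> r0 H; have M0 := bounded_holomorphic_ge0 r0 H.
have [h0|h0] := eqVneq (nrm h) 0.
  by move/eqP: h0; rewrite nrm_eq0 => /eqP ->;
    rewrite linear0 Normc.normc0 nrm0 mulr0.
have {}h0 : 0 < nrm h by rewrite lt_def h0 nrm_ge0.
(* On the square of half side [r] one has [normc z <= 2 * r], hence [nrm (z *: h) <= rho / 2]. The
   one-variable bound [4 * M / r] then yields the constant 16. *)
pose r := rho / (4 * nrm h).
have r'0 : 0 < r by rewrite divr_gt0// mulr_gt0.
have inb (z : C) : `|Re z| <= r -> `|Im z| <= r -> nrm (x + z *: h - x) < rho.
  move=> z1 z2; rewrite addrAC subrr add0r nrmZ.
  have : normc z <= 2 * r by apply: le_trans (normc_leD _) _; lra.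
  rewrite -(ler_pM2r h0) => /le_lt_trans; apply.
  have -> : 2 * r * nrm h = rho / 2 by rewrite /r; field; exact: lt0r_neq0.
  lra.
have dx : differentiable u (x + (0 : C) *: h).
  by have [] := H _ (inb 0 _ _); rewrite //= normr0 ltW.
have := @cauchy_estimate0 R (fun w : C => u (x + w *: h)) r M r'0.
have dG := is_derive_line dx.
rewrite derive_val scale0r addr0.
have -> : 4 * M / r = 16 * M / rho * nrm h.
  by rewrite /r; field; rewrite !lt0r_neq0.
apply=> z z1 z2; have [dz Mz] := H _ (inb z z1 z2) => //.
by have dGz := is_derive_line dz; apply: (@ex_derive _ _ _ _ _ _ _ dGz).
Qed.

Lemma in_ball_segment x y h rho (t : R) : nrm (y - x) < rho ->
  nrm (y + h - x) < rho -> 0 <= t <= 1 -> nrm (y + t%:C *: h - x) < rho.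
Proof.
move=> yx yhx /andP[t0 t1].
have -> : y + t%:C *: h - x =
    (1 - t)%:C *: (y - x) + t%:C *: (y + h - x).
  rewrite ![y + _ - x]addrAC; move: (y - x) => a.
  by rewrite rmorphB /= scalerBl scale1r scalerDr addrA subrK.
apply: le_lt_trans (nrmD _ _) _;
  rewrite !nrmZ !normc_real !ger0_norm ?subr_ge0//.
move: (nrm _) (nrm _) yx yhx => b a ar br.
apply: (@le_lt_trans _ _ (Num.max a b)); last by rewrite gt_max ar.
have -> : Num.max a b = (1 - t) * Num.max a b + t * Num.max a b by ring.
by apply: lerD; apply: ler_wpM2l; rewrite ?subr_ge0// le_max lexx ?orbT.
Qed.

(** With the doubled radius every point of the segment has its own ball of radius [rho], to which
    [diff_bound] applies; 32 is its 16 times the 2 of [mean_value_nrm]. *)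
Lemma increment_bound u x y h rho M : 0 < rho ->
  bounded_holomorphic u x (2 * rho) M ->
  nrm (y - x) < rho -> nrm (y + h - x) < rho ->
  normc (u (y + h) - u y) <= 32 * M / rho * nrm h.
Proof.
move=> r0 H yx yhx; have -> : 32 * M / rho * nrm h = 2 * (16 * M / rho * nrm h).
  by field; exact: lt0r_neq0.
rewrite -[X in normc X]subr0; apply: mean_value_nrm => t t01.
have zx := in_ball_segment yx yhx t01.
split; first by have [] := H (y + t%:C *: h) _ => //; lra.
rewrite subr0; apply: diff_bound => //.
by apply: bounded_holomorphic_sub H; lra.
Qed.

(** The difference is the differential of [v = u(. + h) - u], which [increment_bound] at radius
    [4 * rho] shows to be of order [nrm h]. The Cauchy bound for [v] therefore makes the
    differential of [u] Lipschitz before anything is known about its regularity. *)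
Lemma diff_increment_bound u x y h k rho M : 0 < rho ->
  bounded_holomorphic u x (8 * rho) M ->
  nrm (y - x) < rho -> nrm h < rho ->
  normc ('d u (y + h) k - 'd u y k) <= 128 * M / rho ^+ 2 * nrm h * nrm k.
Proof.
move=> r0 H yx hr; pose v : V -> C := (fun z => u (z + h)) - u.
have near_y z : nrm (z - y) < rho ->
    nrm (z - x) < 4 * rho /\ nrm (z + h - x) < 4 * rho.
  move=> zy; have := nrmD (z - y) (y - x); rewrite addrA subrK => H1.
  by have := nrmD (z - x) h; rewrite addrAC => H2; split; lra.
have Hv : bounded_holomorphic v y rho (32 * M / (4 * rho) * nrm h).
  move=> z /near_y[z1 z2]; split.
    have [|dz _] := H z; first by lra.
    have [|dzh _] := H (z + h); first by lra.
    have dsh := diff_shift dzh.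
    exact: differentiableB.
  apply: (@increment_bound u x) => //; first by rewrite mulr_gt0.
  by apply: bounded_holomorphic_sub H; rewrite subrr nrm0; lra.
have dy : differentiable u y by have [] := H y _ => //; lra.
have dyh : differentiable u (y + h).
  by have [|] := H (y + h) _ => //; have := nrmD (y - x) h; rewrite addrAC; lra.
have dsh := diff_shift dyh.
have iy := differentiableP dy.
have dv : is_diff y v (('d u (y + h) : V -> C) - ('d u y : V -> C)).
  exact: is_diffB.
have dvE : 'd v y = (('d u (y + h) : V -> C) - ('d u y : V -> C)) :> (V -> C).
  exact: diff_val.
have Hk := diff_bound k r0 Hv.
clearbody v; clear near_y Hv dsh iy.
have dvk : 'd v y k = 'd u (y + h) k - 'd u y k by move/(congr1 (@^~ k)): dvE.
rewrite -dvk; apply: le_trans Hk _; apply: eqW.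
by field; exact: lt0r_neq0.
Qed.

(** A quadratic Taylor estimate without a second derivative: [mean_value_nrm] compares with the
    differential at [y], and [diff_increment_bound] controls its variation along the segment. *)
Lemma second_order_bound u x y h rho M : 0 < rho ->
  bounded_holomorphic u x (8 * rho) M ->
  nrm (y - x) < rho -> nrm h < rho ->
  normc (u (y + h) - u y - 'd u y h) <= 256 * M / rho ^+ 2 * nrm h ^+ 2.
Proof.
move=> r0 H yx hr; have M0 : 0 <= M.
  by apply: bounded_holomorphic_ge0 H; lra.
have -> : 256 * M / rho ^+ 2 * nrm h ^+ 2 =
    2 * (128 * M / rho ^+ 2 * nrm h * nrm h).
  by field; exact: lt0r_neq0.
apply: mean_value_nrm => t t01.
have th : nrm (t%:C *: h) <= nrm h.
  by have /andP[? ?] := t01;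
    rewrite nrmZ normc_real ger0_norm// ler_piMl// nrm_ge0.
split.
  by have [] := H (y + t%:C *: h) _ => //; have := nrmD (y - x) (t%:C *: h);
    rewrite addrAC; lra.
apply: le_trans (diff_increment_bound h r0 H yx (le_lt_trans th hr)) _.
rewrite ler_wpM2r ?nrm_ge0// ler_wpM2l// divr_ge0 ?exprn_ge0 ?mulr_ge0//; lra.
Qed.

End HolomorphicEstimates.

(** * Differentiability and symmetry of directional derivatives *)

Section HigherDerivatives.
Local Open Scope complex_scope.
Variable R : realType.
Local Notation C := (Cplx R).
Local Notation normc := (@Normc.normc R).
Local Notation Re := (@complex.Re R).
Local Notation Im := (@complex.Im R).

Lemma cauchy_halves_limit (a : nat -> R) (K : R) :
  (forall m n, `|a m - a n| <= K / 2 ^+ m + K / 2 ^+ n) ->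
  exists l, forall m, `|a m - l| <= 3 * (K / 2 ^+ m).
Proof.
move=> Ha; pose b m := K / 2 ^+ m.
have bS m : b m = 2 * b m.+1 by rewrite /b exprS; field; rewrite expf_neq0.
have step m := Ha m m.+1.
have b0 m : 0 <= b m by have := Ha m m; rewrite subrr normr0 -/(b m); lra.
(* Consecutive terms differ by at most [b m + b m.+1 = 3 * b m.+1], which is exactly how much the
   radius [3 * b m] shrinks; hence the intervals are nested. *)
have [||m|l Hl] := @nested_intervals R (fun m => a m - 3 * b m)
    (fun m => a m + 3 * b m).
- apply/nondecreasing_seqP => m; have := step m; rewrite -/(b m) -/(b m.+1) bS.
  by rewrite ler_norml => /andP[]; have := b0 m.+1; lra.
- apply/nonincreasing_seqP => m; have := step m; rewrite -/(b m) -/(b m.+1) bS.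
  by rewrite ler_norml => /andP[]; have := b0 m.+1; lra.
- by have := b0 m; lra.
exists l => m; have /andP[] := Hl m; rewrite -/(b m) ler_norml => ? ?.
by apply/andP; split; lra.
Qed.

Lemma Cplx_cauchy_halves_limit (a : nat -> C) (K : R) :
  (forall m n, normc (a m - a n) <= K / 2 ^+ m + K / 2 ^+ n) ->
  exists l : C, forall m, normc (a m - l) <= 6 * (K / 2 ^+ m).
Proof.
move=> Ha.
have [m n|p Hp] := @cauchy_halves_limit (fun m => Re (a m)) K.
  apply: le_trans _ (Ha m n); apply: le_trans _ (normc_geRe _).
  by case: (a m) (a n) => [? ?] [? ?].
have [m n|q Hq] := @cauchy_halves_limit (fun m => Im (a m)) K.
  apply: le_trans _ (Ha m n); apply: le_trans _ (normc_geIm _).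
  by case: (a m) (a n) => [? ?] [? ?].
exists (p +i* q) => m; apply: le_trans (normc_leD _) _.
have := Hp m; have := Hq m; case: (a m) => [? ?] /=; lra.
Qed.

Lemma le_halves (X Y Z : R) : (forall m, X <= Y + Z / 2 ^+ m) -> X <= Y.
Proof.
move=> H; rewrite leNgt; apply/negP => YX.
have [|m Hm] := @exists_small_halves R Z (X - Y); first by rewrite subr_gt0.
by have := H m; lra.
Qed.

Variable V : normedModType C.
Implicit Types (u : V -> C) (x y z h k : V) (s : C) (rho M : R).

Definition diff_quotient u k s z : C := s^-1 * (u (z + s *: k) - u z).

Lemma diff_diff_quotient u y k s : differentiable u y ->
  differentiable u (y + s *: k) ->
  differentiable (diff_quotient u k s) y /\
  forall h, 'd (diff_quotient u k s) y h =
    s^-1 * ('d u (y + s *: k) h - 'd u y h).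
Proof.
move=> dy dys; have iys := diff_shift dys; have iy := differentiableP dy.
have iB : is_diff y ((fun z => u (z + s *: k)) - u)
   (('d u (y + s *: k) : V -> C) - ('d u y : V -> C)) by exact: is_diffB.
have iq : is_diff y (diff_quotient u k s)
   (s^-1 \*: (('d u (y + s *: k) : V -> C) - ('d u y : V -> C))).
  exact: is_diffZ.
split; first exact: (@ex_diff _ _ _ _ _ _ _ iq).
have dE : 'd (diff_quotient u k s) y =
   (s^-1 \*: (('d u (y + s *: k) : V -> C) - ('d u y : V -> C))) :> (V -> C).
  exact: diff_val.
by move=> h; move/(congr1 (@^~ h)): dE.
Qed.

(** The bound on the quotient is independent of [s]; its constant 7 rounds up 32/5, from
    [increment_bound] at radius [5 * rho]. The second estimate is [second_order_bound] divided by
    [s]. *)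
Lemma diff_quotient_bounds u x k s rho M : 0 < rho ->
  bounded_holomorphic u x (10 * rho) M -> s != 0 -> normc s * nrm k < rho ->
  bounded_holomorphic (diff_quotient u k s) x rho (7 * M / rho * nrm k) /\
  forall z, nrm (z - x) < rho ->
    normc (diff_quotient u k s z - 'd u z k)
      <= 256 * M / rho ^+ 2 * nrm k ^+ 2 * normc s.
Proof.
move=> r0 H s0 sk; have M0 : 0 <= M by apply: bounded_holomorphic_ge0 H; lra.
have ns : 0 < normc s.
  by rewrite lt_def normc_ge0 andbT;
    apply: contra s0 => /eqP/Normc.eq0_normc ->.
have skr : nrm (s *: k) < rho by rewrite nrmZ.
have shift z : nrm (z - x) < rho -> nrm (z + s *: k - x) < 2 * rho.
  by move=> zx; have := nrmD (z - x) (s *: k); rewrite addrAC; lra.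
split=> z zx; have zsx := shift z zx.
  have [|dz _] := H z; first by lra.
  have [|dzs _] := H (z + s *: k); first by lra.
  split; first by have [] := diff_diff_quotient dz dzs.
  rewrite /diff_quotient Normc.normcM Normc.normcV.
  have := @increment_bound R V u x z (s *: k) (5 * rho) M.
  have -> : 2 * (5 * rho) = 10 * rho by ring.
  move=> /(_ _ H _ _) Hi.
  rewrite mulrC ler_pdivrMr//; apply: le_trans (Hi _ _ _) _; try lra.
  rewrite nrmZ; have := nrm_ge0 k; set t := nrm k => t0.
  have : 0 <= M / rho * (t * normc s).
    by rewrite !mulr_ge0 ?invr_ge0// ltW.
  have -> : 32 * M / (5 * rho) * (normc s * t) =
      32 / 5 * (M / rho * (t * normc s)).
    by field; exact: lt0r_neq0.
  have -> : 7 * M / rho * t * normc s = 7 * (M / rho * (t * normc s)).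
    by field; exact: lt0r_neq0.
  lra.
have dz : differentiable u z by have [] := H z _ => //; lra.
have -> : diff_quotient u k s z - 'd u z k =
    s^-1 * (u (z + s *: k) - u z - 'd u z (s *: k)).
  have -> : 'd u z (s *: k) = s * 'd u z k by rewrite linearZ.
  by rewrite /diff_quotient; field.
rewrite Normc.normcM Normc.normcV mulrC ler_pdivrMr//.
have := @second_order_bound R V u x z (s *: k) rho M r0.
move=> /(_ _ zx skr); rewrite nrmZ => Hs.
apply: le_trans (Hs _) _; last by apply: eqW; ring.
by apply: bounded_holomorphic_sub H; rewrite subrr nrm0; lra.
Qed.

(** Uniform closeness passes to differentials by the Cauchy bound for [q - v]. Here [v] is another
    quotient in [differentiable_diff], and the directional derivative itself, with [eps = 0], in
    [diffC]. *)
Lemma diff_quotient_diff_close u v x k s rho M eps : 0 < rho ->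
  bounded_holomorphic u x (10 * rho) M -> s != 0 -> normc s * nrm k < rho ->
  (forall z, nrm (z - x) < rho -> differentiable v z /\
     normc (v z - 'd u z k) <= eps) ->
  forall h, normc ('d (diff_quotient u k s) x h - 'd v x h)
    <= 16 * (256 * M / rho ^+ 2 * nrm k ^+ 2 * normc s + eps) / rho * nrm h.
Proof.
move=> r0 H s0 sk Hv h.
have [Hq Hqd] := diff_quotient_bounds r0 H s0 sk.
move: (diff_quotient u k s) Hq Hqd => q Hq Hqd.
have x0 : nrm (x - x) < rho by rewrite subrr nrm0.
have [dq _] := Hq x x0; have [dv _] := Hv x x0.
have iq := differentiableP dq; have iv := differentiableP dv.
have iw : is_diff x (q - v) (('d q x : V -> C) - ('d v x : V -> C)).
  exact: is_diffB.
have wE : 'd (q - v) x = (('d q x : V -> C) - ('d v x : V -> C)) :> (V -> C).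
  exact: diff_val.
have Hw : bounded_holomorphic (q - v) x rho
    (256 * M / rho ^+ 2 * nrm k ^+ 2 * normc s + eps).
  move=> z zx; have [dqz _] := Hq z zx; have [dvz vz] := Hv z zx.
  split; first exact: differentiableB.
  have -> : (q - v) z = (q z - 'd u z k) - (v z - 'd u z k).
    by rewrite opprB addrA subrK.
  apply: le_trans (le_normcD _ _) _; rewrite normcN; apply: lerD => //.
  exact: Hqd.
have := diff_bound h r0 Hw; move: wE; move: (q - v) => w wE.
have wh : 'd w x h = 'd q x h - 'd v x h by move/(congr1 (@^~ h)): wE.
by rewrite -wh.
Qed.

(** The difference quotients [q m] with steps [sigma / 2 ^+ m] converge uniformly to the directional
    derivative, and their differentials at [x] form a Cauchy sequence. The limit [ell] of the latter
    is the differential sought. *)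
Lemma differentiable_diff u x k rho M : 0 < rho ->
  bounded_holomorphic u x (10 * rho) M ->
  differentiable (fun z => 'd u z k) x.
Proof.
move=> r0 H; have M0 : 0 <= M by apply: bounded_holomorphic_ge0 H; lra.
have k0 := nrm_ge0 k.
(* Keeps [normc (s m) * nrm k] below [rho]; the summand 1 covers [k = 0]. *)
pose sigma := rho / (2 * (nrm k + 1)).
have sigma0 : 0 < sigma by rewrite divr_gt0// mulr_gt0// ltr_wpDl.
pose s m : C := (sigma / 2 ^+ m)%:C.
have ns m : normc (s m) = sigma / 2 ^+ m.
  by rewrite /s normc_real gtr0_norm// divr_gt0// exprn_gt0.
have s0 m : s m != 0.
  apply/eqP => sm0; have := ns m; rewrite sm0 Normc.normc0 => /esym/eqP.
  by rewrite gt_eqF// divr_gt0// exprn_gt0.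
have sk m : normc (s m) * nrm k < rho.
  rewrite ns; apply: (@le_lt_trans _ _ (sigma * nrm k)).
    rewrite ler_wpM2r// ler_pdivrMr ?exprn_gt0//; apply: ler_peMr;
      first exact: ltW.
    by apply: exprn_ege1; rewrite ler1n.
  by rewrite /sigma mulrAC ltr_pdivrMr ?mulr_gt0 ?ltr_wpDl// ltr_pM2l//; lra.
pose q m := diff_quotient u k (s m).
have Hq m : bounded_holomorphic (q m) x rho (7 * M / rho * nrm k).
  by have [] := diff_quotient_bounds r0 H (s0 m) (sk m).
pose K1 := 256 * M / rho ^+ 2 * nrm k ^+ 2.
have K10 : 0 <= K1.
  apply: mulr_ge0; last exact: exprn_ge0.
  by apply: divr_ge0; [rewrite mulr_ge0 ?ler0n//|exact/exprn_ge0/ltW].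
have Hqd m z : nrm (z - x) < rho -> normc (q m z - 'd u z k) <= K1 * (sigma /
  2 ^+ m).
  by move=> zx; have [_] := diff_quotient_bounds r0 H (s0 m) (sk m);
    rewrite ns; apply.
pose K2 := 16 * (K1 * sigma) / rho.
have K20 : 0 <= K2.
  apply: divr_ge0; last exact: ltW.
  by apply: mulr_ge0; [rewrite ler0n|apply: mulr_ge0 => //; exact: ltW].
have Hcauchy h m n : normc ('d (q m) x h - 'd (q n) x h) <=
    (K2 * nrm h) / 2 ^+ m + (K2 * nrm h) / 2 ^+ n.
  have :=
    @diff_quotient_diff_close u (q n) x k (s m) rho M _ r0 H (s0 m) (sk m).
  move=> /(_ (K1 * (sigma / 2 ^+ n)))=> Hc.
  apply: le_trans (Hc _ h) _.
    by move=> z zx; split; [have [] := Hq n z zx|exact: Hqd].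
  rewrite ns -/K1 /K2; apply: eqW; field.
  by rewrite !expf_neq0// lt0r_neq0.
have /choice[ell Hell] : forall h, exists l, forall m,
    normc ('d (q m) x h - l) <= 6 * ((K2 * nrm h) / 2 ^+ m).
  by move=> h; exact: Cplx_cauchy_halves_limit (Hcauchy h).
(* Each ['d (q m) x] is linear and [ell] is its limit, so the defect of linearity is at most a
   constant over [2 ^+ m] for every [m]. *)
have ell_lin : linear ell.
  move=> a h1 h2; apply/eqP; rewrite -subr_eq0; apply/eqP/Normc.eq0_normc.
  apply/eqP; rewrite eq_le normc_ge0 andbT.
  apply: (@le_halves _ _ (6 * (K2 * nrm (a *: h1 + h2)) +
    normc a * (6 * (K2 * nrm h1)) + 6 * (K2 * nrm h2))) => m.
  have -> : ell (a *: h1 + h2) - (a *: ell h1 + ell h2) =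
      - ('d (q m) x (a *: h1 + h2) - ell (a *: h1 + h2)) +
      a * ('d (q m) x h1 - ell h1) + ('d (q m) x h2 - ell h2).
    have -> : 'd (q m) x (a *: h1 + h2) = a * 'd (q m) x h1 + 'd (q m) x h2.
      by rewrite linearP.
    rewrite -[a *: ell h1]/(a * ell h1).
    move: ('d _ x h1 : C) ('d _ x h2 : C) (ell _) (ell h1) (ell h2) =>
      ? ? ? ? ?.
    ring.
  rewrite add0r; apply: le_trans (le_normcD _ _) _.
  rewrite 2!mulrDl; apply: lerD; last by rewrite -[leRHS]mulrA; exact: Hell.
  apply: le_trans (le_normcD _ _) _; apply: lerD.
    by rewrite normcN -[leRHS]mulrA; exact: Hell.
  rewrite Normc.normcM -[leRHS]mulrA; apply: ler_wpM2l; first exact: normc_ge0.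
  by rewrite -[leRHS]mulrA; exact: Hell.
pose L : {linear V -> C} :=
  HB.pack ell (GRing.isLinear.Build C V C _ ell ell_lin).
pose M2 := 7 * M / rho * nrm k.
have M20 : 0 <= M2 by apply: bounded_holomorphic_ge0 r0 (Hq 0%N).
apply: (@nrm_differentiable R V C _ x L (16 * M2 / rho)).
  move=> h; rewrite nrm_Cplx.
  apply: (@le_halves _ _ (6 * (K2 * nrm h))) => m.
  have -> : L h = 'd (q m) x h - ('d (q m) x h - ell h) by rewrite /L /=; ring.
  apply: le_trans (le_normcD _ _) _; rewrite normcN; apply: lerD.
    exact: diff_bound.
  by rewrite -mulrA; exact: Hell.
pose rho1 := rho / 8; have rho10 : 0 < rho1 by rewrite divr_gt0.
pose K3 := 256 * M2 / rho1 ^+ 2.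
have K30 : 0 <= K3.
  by apply: divr_ge0; [rewrite mulr_ge0 ?ler0n//|exact/exprn_ge0/ltW].
move=> e e0; exists (Num.min rho1 (e / (K3 + 1))).
  by rewrite lt_min rho10 divr_gt0// ltr_wpDl.
move=> h; rewrite lt_min => /andP[h1 h2].
suff Hh : nrm ('d u (x + h) k - 'd u x k - L h) <= K3 * nrm h ^+ 2.
  apply: le_trans Hh _; rewrite expr2 mulrA ler_wpM2r ?nrm_ge0//.
  move: h2; rewrite ltr_pdivlMr ?ltr_wpDl//; have := nrm_ge0 h; lra.
rewrite nrm_Cplx.
apply: (@le_halves _ _ (2 * (K1 * sigma) + 6 * (K2 * nrm h))) => m.
have xx : nrm (x - x) < rho by rewrite subrr nrm0.
have xhx : nrm (x + h - x) < rho by rewrite addrAC subrr add0r;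
  rewrite /rho1 in h1; lra.
(* The errors [A1], [A2], [A3] vanish as [m] grows, while [A4] has a constant independent of [m],
   because all [q m] share the bound [M2]. *)
have A1 := Hqd m x xx; have A2 := Hqd m (x + h) xhx; have A3 := Hell h m.
have A4 : normc (q m (x + h) - q m x - 'd (q m) x h) <= K3 * nrm h ^+ 2.
  apply: (@second_order_bound R V (q m) x x h rho1 M2 rho10 _ _ h1).
    by have -> : 8 * rho1 = rho by rewrite /rho1; field.
  by rewrite subrr nrm0.
have -> : 'd u (x + h) k - 'd u x k - L h =
   (q m (x + h) - q m x - 'd (q m) x h) + ('d (q m) x h - ell h) +
   (q m x - 'd u x k) - (q m (x + h) - 'd u (x + h) k) by rewrite /L /=; ring.
apply: le_trans (le_normcD _ _) _; rewrite normcN.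
have := le_normcD
   ((q m (x + h) - q m x - 'd (q m) x h) + ('d (q m) x h - ell h))
   (q m x - 'd u x k).
have := le_normcD (q m (x + h) - q m x - 'd (q m) x h) ('d (q m) x h - ell h).
move: A1 A2 A3 A4.
have -> : K1 * (sigma / 2 ^+ m) = K1 * sigma / 2 ^+ m by rewrite mulrA.
have -> : (2 * (K1 * sigma) + 6 * (K2 * nrm h)) / 2 ^+ m =
   2 * (K1 * sigma / 2 ^+ m) + 6 * (K2 * nrm h / 2 ^+ m).
  by field; rewrite expf_neq0.
lra.
Qed.

(** One expression approximates both sides: the quotient of ['d u (x + t *: k) h - 'd u x h] by [t]
    is the differential along [h] of the difference quotient in direction [k] ([B1]), and the
    difference quotient in direction [k] of the derivative along [h] ([B2]). *)
Lemma diffC u x h k rho M : 0 < rho -> bounded_holomorphic u x (20 * rho) M ->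
  'd (fun z => 'd u z k) x h = 'd (fun z => 'd u z h) x k.
Proof.
move=> r0 H; have M0 : 0 <= M by apply: bounded_holomorphic_ge0 H; lra.
have k0 := nrm_ge0 k; have h0 := nrm_ge0 h.
have dd l z : nrm (z - x) < rho -> differentiable (fun z => 'd u z l) z.
  move=> zx; apply: (@differentiable_diff u z l rho M r0).
  by apply: bounded_holomorphic_sub H; lra.
have xx : nrm (x - x) < rho by rewrite subrr nrm0.
pose a : C := 'd (fun z => 'd u z k) x h.
pose b : C := 'd (fun z => 'd u z h) x k.
suff ab : normc (a - b) <= 0.
  apply: (subr0_eq (x := a) (y := b)); apply: Normc.eq0_normc.
  by apply/eqP; rewrite eq_le normc_ge0 andbT.
pose K := 16 * (256 * M / rho ^+ 2 * nrm k ^+ 2) / rho * nrm h.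
have K0 : 0 <= K.
  apply: mulr_ge0; last exact: h0.
  apply: divr_ge0; last exact: ltW.
  apply: mulr_ge0; first by rewrite ler0n.
  apply: mulr_ge0; last exact: exprn_ge0.
  by apply: divr_ge0; [rewrite mulr_ge0 ?ler0n//|exact/exprn_ge0/ltW].
apply: (@le_halves _ _ (K + nrm k)) => m.
pose e : R := 1 / 2 ^+ m; have e0 : 0 < e by rewrite divr_gt0// exprn_gt0.
have [d d0 Hd] := differentiable_nrm (dd h x xx) e0.
pose t := Num.min e (Num.min d rho / (nrm k + 1)).
have kk : 0 < nrm k + 1 by rewrite ltr_wpDl.
have t0 : 0 < t by rewrite lt_min e0 divr_gt0// lt_min d0.
have te : t <= e by rewrite ge_min lexx.
have tk : t * nrm k < Num.min d rho.
  have : t <= Num.min d rho / (nrm k + 1) by rewrite /t ge_min lexx orbT.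
  rewrite ler_pdivlMr//; lra.
have nt : normc t%:C = t by rewrite normc_real gtr0_norm.
have tC0 : t%:C != 0 :> C by apply/eqP => /(congr1 normc);
  rewrite nt Normc.normc0 => /eqP; rewrite gt_eqF.
move: tk; rewrite lt_min => /andP[tkd tkr].
have ntk : nrm (t%:C *: k) = t * nrm k by rewrite nrmZ nt.
have B1 : normc ((t%:C)^-1 * ('d u (x + t%:C *: k) h - 'd u x h) - a) <= K * t.
  have := @diff_quotient_diff_close u (fun z => 'd u z k) x k t%:C rho M 0 r0.
  rewrite nt => Hc.
  have [|dx _] := H x; first by lra.
  have [|dxt _] := H (x + t%:C *: k); first by rewrite addrAC subrr add0r ntk;
    lra.
  have [_ <-] := diff_diff_quotient dx dxt.
  apply: le_trans (Hc _ tC0 tkr _ h) _.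
  - by apply: bounded_holomorphic_sub H; rewrite subrr nrm0; lra.
  - by move=> z zx; split; [exact: dd|rewrite subrr Normc.normc0].
  - by rewrite addr0 /K; apply: eqW; field; exact: lt0r_neq0.
have B2 : normc ((t%:C)^-1 * ('d u (x + t%:C *: k) h - 'd u x h) - b)
    <= e * nrm k.
  have Hdt := Hd (t%:C *: k); rewrite ntk nrm_Cplx in Hdt.
  have dZ : 'd (fun z => 'd u z h) x (t%:C *: k) = t%:C * b by exact: linearZ.
  have B2 : normc ('d u (x + t%:C *: k) h - 'd u x h - t%:C * b)
      <= e * (t * nrm k).
    by rewrite -dZ; exact: Hdt.
  have -> : (t%:C)^-1 * ('d u (x + t%:C *: k) h - 'd u x h) - b =
     (t%:C)^-1 * ('d u (x + t%:C *: k) h - 'd u x h - t%:C * b) by field.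
  rewrite Normc.normcM Normc.normcV nt mulrC ler_pdivrMr//.
  by apply: le_trans B2 _; apply: eqW; ring.
set c := _ * _ in B1 B2.
have -> : a - b = (c - b) - (c - a) by ring.
apply: le_trans (le_normcD _ _) _; rewrite normcN.
have : K * t <= K * e by rewrite ler_wpM2l.
have -> : (K + nrm k) / 2 ^+ m = K * e + e * nrm k by rewrite /e; field;
  rewrite expf_neq0.
lra.
Qed.

End HigherDerivatives.

(** * Holomorphic functions and their partial derivatives *)

Lemma near_norm (K : numFieldType) (V : normedModType K) (x : V) (P : set V) :
  (\near x, P x) -> exists2 d, 0 < d & forall h, `|h| < d -> P (x + h).
Proof.
move=> /nbhs_normP[d d0 Hd]; exists d => // h hd; apply: Hd.
by rewrite /= opprD addrA subrr sub0r normrN.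
Qed.

(* Sealed copy of [partial]: comparing two partial derivatives must not unfold
   them down to limits. *)
HB.lock Definition pder (R : realType) (n : nat) (i : 'I_n)
  (g : Cn R n -> Cplx R) : Cn R n -> Cplx R := partial i g.

Section HolomorphicFunctions.
Variables (R : realType) (n : nat).
Local Notation C := (Cplx R).
Local Notation X := (Cn R n).
Implicit Types (W : set X) (u v g : X -> C) (i j : 'I_n) (x p : X).

Lemma near_eq_differentiable u v x :
  (\near x, u x = v x) -> differentiable u x -> differentiable v x.
Proof.
move=> uv du; have uvx : u x = v x by exact: nbhs_singleton uv.
have [] // := @expansion_differentiable _ _ _ v x ('d u x : {linear X -> C}).
  exact: diff_continuous.
move=> e e0; have [d d0 Hd] := differentiable_expansion du e0.
have [d' d'0 Hd'] := near_norm uv.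
have [dd'|dd'] := real_leP (gtr0_real d0) (gtr0_real d'0).
  exists d => // h hd; rewrite -uvx -(Hd' h); first exact: Hd.
  exact: lt_le_trans dd'.
exists d' => // h hd; rewrite -uvx -(Hd' h)//; apply: Hd.
exact: lt_trans dd'.
Qed.

Lemma open_near_eq W u v x : open W -> W x -> (forall y, W y -> u y = v y) ->
  \near x, u x = v x.
Proof.
move=> oW Wx uv; near=> y; apply: uv; near: y; exact: open_nbhs_nbhs.
Unshelve. all: by end_near. Qed.

Lemma holomorphic_eq W u v : open W -> (forall y, W y -> u y = v y) ->
  holomorphic W u -> holomorphic W v.
Proof.
move=> oW uv hu x Wx; apply: near_eq_differentiable (hu x Wx).
exact: open_near_eq uv.
Qed.

Lemma holomorphicS W W' u : W' `<=` W -> holomorphic W u -> holomorphic W' u.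
Proof. by move=> W'W hu x /W'W/hu. Qed.

Lemma holomorphic_cst W (c : C) : holomorphic W (fun=> c).
Proof. by move=> x _; exact: differentiable_cst. Qed.

Lemma holomorphicD W u v : holomorphic W u -> holomorphic W v ->
  holomorphic W (fun x => u x + v x).
Proof. by move=> hu hv x Wx; apply: (@differentiableD _ _ _ u v); auto. Qed.

Lemma holomorphicB W u v : holomorphic W u -> holomorphic W v ->
  holomorphic W (fun x => u x - v x).
Proof. by move=> hu hv x Wx; apply: (@differentiableB _ _ _ u v); auto. Qed.

Lemma holomorphicM W u v : holomorphic W u -> holomorphic W v ->
  holomorphic W (fun x => u x * v x).
Proof. by move=> hu hv x Wx; apply: (@differentiableM _ _ u v); auto. Qed.

Lemma holomorphicX W u m : holomorphic W u -> holomorphic W (fun x => u x ^+ m).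
Proof.
move=> hu; elim: m => [|m IH]; first exact: holomorphic_cst.
by under eq_fun do rewrite exprS; exact: holomorphicM.
Qed.

Lemma holomorphic_sum W (I : Type) (r : seq I) (P : pred I) (F : I -> X -> C) :
  (forall k, P k -> holomorphic W (F k)) ->
  holomorphic W (fun x => \sum_(k <- r | P k) F k x).
Proof.
move=> hF; elim: r => [|a r IH].
  by under eq_fun do rewrite big_nil; exact: holomorphic_cst.
have [Pa|nPa] := boolP (P a); last first.
  by under eq_fun do rewrite big_cons (negbTE nPa); exact: IH.
by under eq_fun do rewrite big_cons Pa; exact: holomorphicD (hF a Pa) IH.
Qed.

Lemma holomorphic_prod W (I : Type) (r : seq I) (F : I -> X -> C) :
  (forall k, holomorphic W (F k)) ->
  holomorphic W (fun x => \prod_(k <- r) F k x).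
Proof.
move=> hF; elim: r => [|a r IH].
  by under eq_fun do rewrite big_nil; exact: holomorphic_cst.
by under eq_fun do rewrite big_cons; exact: holomorphicM (hF a) IH.
Qed.

Definition coord i x : C := (x : 'rV[C]_n) 0 i.

Lemma holomorphic_coord W i : holomorphic W (coord i).
Proof. by move=> x _; exact: differentiable_coord. Qed.

Lemma holomorphic_bounded W u x : open W -> W x -> holomorphic W u ->
  exists rho M : R, 0 < rho /\ bounded_holomorphic u x rho M.
Proof.
move=> oW Wx hu.
have Wn : \forall y \near x, W y /\ `|u y - u x| < 1.
  near=> y; split; first by near: y; exact: open_nbhs_nbhs.
  near: y; apply: cvgr_distC_lt => //.
  exact: differentiable_continuous (hu x Wx).
have [d d0 Hd] := near_norm Wn.
have [rho rho0 dE] := Cplx_gt0P d0.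
exists rho, (nrm (u x) + 1); split=> // y yx.
have [|Wy Hy] := Hd (y - x); first by rewrite /= nrmE dE ltcR.
rewrite addrC subrK in Wy Hy; split; first exact: hu.
rewrite -nrm_Cplx -[u y](subrK (u x)) addrC; apply: le_trans (nrmD _ _) _.
by rewrite lerD2l -lecR -nrmE ltW.
Unshelve. all: by end_near. Qed.

Local Notation e_ i := (delta_mx 0 i : X).

Lemma pder_diff i u x : differentiable u x -> pder i u x = 'd u x (e_ i).
Proof. by move=> du; rewrite pder.unlock /partial deriveE. Qed.

Lemma holomorphic_pder W i u : open W -> holomorphic W u ->
  holomorphic W (pder i u).
Proof.
move=> oW hu x Wx.
have [rho [M [r0 H]]] := holomorphic_bounded oW Wx hu.
have d : differentiable (fun z => 'd u z (e_ i)) x.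
  apply: (@differentiable_diff R X u x (e_ i) (rho / 10) M).
    by rewrite divr_gt0.
  by have -> : 10 * (rho / 10) = rho by field.
apply: near_eq_differentiable d; apply: (open_near_eq oW Wx) => y Wy.
by rewrite pder_diff//; exact: hu.
Qed.

Lemma pder_eq W u v i x : open W -> (forall y, W y -> u y = v y) -> W x ->
  pder i u x = pder i v x.
Proof.
by move=> oW uv Wx; rewrite pder.unlock; apply: near_eq_derive;
  exact: open_near_eq uv.
Qed.

Lemma pderC W u i j x : open W -> holomorphic W u -> W x ->
  pder i (pder j u) x = pder j (pder i u) x.
Proof.
move=> oW hu Wx; have [rho [M [r0 H]]] := holomorphic_bounded oW Wx hu.
have E k l : pder k (pder l u) x = 'd (fun z => 'd u z (e_ l)) x (e_ k).
  rewrite (@pder_eq W (pder l u) (fun z => 'd u z (e_ l)))//; last first.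
    by move=> y Wy; exact: pder_diff (hu y Wy).
  apply: pder_diff; apply: (@differentiable_diff R X u x (e_ l) (rho / 10) M).
    by rewrite divr_gt0.
  by have -> : 10 * (rho / 10) = rho by field.
rewrite (E i j) (E j i); apply: (@diffC R X u x _ _ (rho / 20) M).
  by rewrite divr_gt0.
by have -> : 20 * (rho / 20) = rho by field.
Qed.

Lemma pderD u v i x : differentiable u x -> differentiable v x ->
  pder i (fun y => u y + v y) x = pder i u x + pder i v x.
Proof.
by move=> du dv; rewrite pder.unlock; apply: (@deriveD _ _ _ u v);
  exact: diff_derivable.
Qed.

Lemma pderM u v i x : differentiable u x -> differentiable v x ->
  pder i (fun y => u y * v y) x = pder i u x * v x + u x * pder i v x.
Proof.
move=> du dv; rewrite pder.unlock [LHS](@deriveM _ _ u v);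
  [|exact: diff_derivable..].
by rewrite addrC /GRing.scale /= [v x * _]mulrC.
Qed.

Lemma pder_cst (c : C) i x : pder i (fun=> c) x = 0.
Proof. by rewrite pder.unlock; exact: derive_cst. Qed.

Lemma pderZ (c : C) u i x : differentiable u x ->
  pder i (fun y => c * u y) x = c * pder i u x.
Proof.
move=> du; rewrite pderM// ?pder_cst ?mul0r ?add0r//.
Qed.

Lemma pder_sum (I : Type) (r : seq I) (F : I -> X -> C) i x :
  (forall k, differentiable (F k) x) ->
  pder i (fun y => \sum_(k <- r) F k y) x = \sum_(k <- r) pder i (F k) x.
Proof.
move=> dF; elim: r => [|a r IH].
  by rewrite big_nil; under eq_fun do rewrite big_nil; exact: pder_cst.
rewrite big_cons; under eq_fun do rewrite big_cons.
rewrite pderD// ?IH//.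
have := @holomorphic_sum [set x] I r xpredT F; apply => // k _ y ->; exact: dF.
Qed.

Lemma pder_coord i j x : pder i (coord j) x = (i == j)%:R.
Proof.
rewrite pder.unlock; apply/lim_near_cst; first exact: norm_hausdorff.
near=> h; have h0 : h != 0 by near: h; exact: nbhs_dnbhs_neq.
rewrite /coord /= !mxE eqxx /= addrK /GRing.scale /= eq_sym mulrA mulVf//.
by rewrite mul1r.
Unshelve. all: by end_near. Qed.

End HolomorphicFunctions.

(** * Order of vanishing and Taylor expansion *)

Section IteratedPartials.
Variables (R : realType) (n : nat).
Local Notation C := (Cplx R).
Local Notation X := (Cn R n).
Variables (W : set X) (oW : open W).
Implicit Types (u v h : X -> C) (i j : 'I_n) (x p : X) (w : seq 'I_n).

(** Words replace multi-indices: inductions peel off one derivative at a time, and only the length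
    of the word matters for the order. *)
Definition pders w u : X -> C := foldr (@pder R n) u w.

Lemma pders_cons i w u : pders (i :: w) u = pder i (pders w u).
Proof. by []. Qed.

Lemma holomorphic_pders w u : holomorphic W u -> holomorphic W (pders w u).
Proof. by move=> hu; elim: w => //= i w; exact: holomorphic_pder. Qed.

Lemma pders_eq w u v x : (forall y, W y -> u y = v y) -> W x ->
  pders w u x = pders w v x.
Proof.
move=> uv; elim: w x => [|i w IH] x Wx; first exact: uv.
by rewrite !pders_cons; apply: (pder_eq _ oW) => // y; exact: IH.
Qed.

Lemma pdersD w u v x : holomorphic W u -> holomorphic W v -> W x ->
  pders w (fun y => u y + v y) x = pders w u x + pders w v x.
Proof.
move=> hu hv; elim: w x => [//|i w IH] x Wx; rewrite !pders_cons.
rewrite (@pder_eq _ _ W _ (fun y => pders w u y + pders w v y))//.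
by rewrite pderD//; exact: holomorphic_pders.
Qed.

Lemma pdersZ w (c : C) u x : holomorphic W u -> W x ->
  pders w (fun y => c * u y) x = c * pders w u x.
Proof.
move=> hu; elim: w x => [//|i w IH] x Wx; rewrite !pders_cons.
rewrite (@pder_eq _ _ W _ (fun y => c * pders w u y))//.
by rewrite pderZ//; exact: holomorphic_pders.
Qed.

Lemma mpartialE (b : 'I_n -> nat) :
  exists2 w, size w = (\sum_i b i)%N & forall u, mpartial b u = pders w u.
Proof.
exists (flatten [seq nseq (b i) i | i <- enum 'I_n]).
  rewrite size_flatten /shape -map_comp sumnE big_map big_enum /=.
  by apply: eq_bigr => i _; rewrite /= size_nseq.
move=> u; rewrite /mpartial /pders pder.unlock;
  elim: (enum 'I_n) => [|i s IHs]; first exact: erefl.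
rewrite [LHS]/= IHs [flatten _]/= foldr_cat; move: (foldr _ u _) => v.
elim: (b i) => [|m IHm]; first exact: erefl.
by rewrite iterS IHm.
Qed.

(** Vanishing to order at least [k]: all iterated partials of order less than [k] are zero at
    [p]. *)
Fixpoint vanishes (k : nat) u p : Prop :=
  if k is m.+1 then u p = 0 /\ forall i, vanishes m (pder i u) p else True.

Lemma vanishes_eq k u v p : (forall y, W y -> u y = v y) -> W p ->
  vanishes k u p -> vanishes k v p.
Proof.
elim: k u v => [|k IH] u v uv Wp; first exact.
move=> [up du]; split; first by rewrite -(uv p Wp).
move=> i; apply: IH Wp (du i) => y Wy; exact: (pder_eq _ oW uv Wy).
Qed.

Lemma vanishesW k m u p : (m <= k)%N -> vanishes k u p -> vanishes m u p.
Proof.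
elim: k m u => [|k IH] [|m] u; [by []|by []|by []|].
rewrite ltnS => mk [up du]; split=> [//|i]; exact: IH (du i).
Qed.

Lemma vanishes_pder k u p i : vanishes k u p -> vanishes k.-1 (pder i u) p.
Proof. by case: k => //= k [_]. Qed.

Lemma vanishesD k u v p : holomorphic W u -> holomorphic W v -> W p ->
  vanishes k u p -> vanishes k v p -> vanishes k (fun x => u x + v x) p.
Proof.
move=> + + Wp; elim: k u v => [//|k IH] u v hu hv [up du] [vp dv].
split=> [|i]; first by rewrite up vp addr0.
have := IH _ _ (holomorphic_pder i oW hu) (holomorphic_pder i oW hv)
  (du i) (dv i).
by apply: vanishes_eq => // y Wy; rewrite pderD//; [exact: hu|exact: hv].
Qed.

Lemma vanishesM k m u v p : holomorphic W u -> holomorphic W v -> W p ->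
  vanishes k u p -> vanishes m v p -> vanishes (k + m) (fun x => u x * v x) p.
Proof.
(* Only [N <= k + m] is kept: the Leibniz rule lowers [k] or [m] by one, and the truncated
   predecessor of 0 breaks the equality. *)
move=> + + Wp; move: (leqnn (k + m)); move: {1 3}(k + m)%N => N.
elim: N k m u v => [//|N IH] k m u v km hu hv ku mv; split.
  case: k km ku => [|k] km /=; last by move=> [-> _]; rewrite mul0r.
  by case: m km mv => [//|m] km /= [-> _]; rewrite mulr0.
move=> i; have hui := holomorphic_pder i oW hu.
have hvi := holomorphic_pder i oW hv.
apply: (@vanishes_eq _ (fun x => pder i u x * v x + u x * pder i v x)) => //.
  by move=> y Wy; rewrite pderM//; [exact: hu|exact: hv].
apply: vanishesD Wp _ _; [exact: holomorphicM|exact: holomorphicM| |].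
- apply: (IH k.-1 m) => //; last exact: vanishes_pder.
  by move: km; rewrite -ltnS; case: (k) => [|k']//= km; apply: ltnW.
- apply: (IH k m.-1) => //; last exact: vanishes_pder.
  by move: km; case: (m) => [|m']//=; rewrite ?addnS// addn0 => km; exact: ltnW.
Qed.

Lemma vanishes0 k p : W p -> vanishes k (fun=> 0) p.
Proof.
move=> Wp; elim: k => [//|k IH]; split=> [//|i].
by apply: (vanishes_eq _ Wp IH) => y _; rewrite pder_cst.
Qed.

Lemma vanishes_sum k (I : Type) (r : seq I) (F : I -> X -> C) p : W p ->
  (forall a, holomorphic W (F a)) -> (forall a, vanishes k (F a) p) ->
  vanishes k (fun x => \sum_(a <- r) F a x) p.
Proof.
move=> Wp hF kF; elim: r => [|a r IH].
  by under eq_fun do rewrite big_nil; exact: vanishes0.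
under eq_fun do rewrite big_cons.
by apply: vanishesD => //; exact: holomorphic_sum.
Qed.

Lemma vanishes_pders w k u p :
  vanishes (size w + k) u p -> vanishes k (pders w u) p.
Proof.
elim: w k => [//|i w IH] k; rewrite pders_cons [size _]/= addSnnS.
by move=> /IH[_]; apply.
Qed.

Lemma vanishes_coord i p : vanishes 1 (fun x => coord i x - coord i p) p.
Proof. by split; rewrite ?subrr. Qed.

(** This is [s!] times the homogeneous part of degree [s] of the Taylor series of [h] at [p]:
    summing over words counts a multi-index [alpha] exactly [s! / alpha!] times. *)
Fixpoint taylor_term (s : nat) h p x : C :=
  if s is s'.+1
  then \sum_i (coord i x - coord i p) * taylor_term s' (pder i h) p x
  else h p.

Lemma holomorphic_taylor_term s h p : holomorphic W (taylor_term s h p).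
Proof.
elim: s h => [|s IH] h /=; first exact: holomorphic_cst.
apply: holomorphic_sum => i _; apply: holomorphicM; last exact: IH.
by apply: holomorphicB; [exact: holomorphic_coord|exact: holomorphic_cst].
Qed.

Lemma taylor_term_eq s u v p x : (forall y, W y -> u y = v y) -> W p ->
  taylor_term s u p x = taylor_term s v p x.
Proof.
move=> + Wp; elim: s u v => [|s IH] u v uv /=; first exact: uv.
apply: eq_bigr => i _.
by rewrite (IH _ (pder i v) (fun y Wy => pder_eq i oW uv Wy)).
Qed.

Lemma vanishes_taylor_term s h p : W p -> vanishes s (taylor_term s h p) p.
Proof.
move=> Wp; elim: s h => [//|s IH] h.
have hc i : holomorphic W (fun x => coord i x - coord i p).
  by apply: holomorphicB; [exact: holomorphic_coord|exact: holomorphic_cst].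
apply: (vanishes_sum _ Wp) => i.
  by apply: holomorphicM (hc i) _; exact: holomorphic_taylor_term.
rewrite -add1n.
apply: (vanishesM (hc i) _ Wp (vanishes_coord i p) (IH _)).
exact: holomorphic_taylor_term.
Qed.

(** The product rule gives one copy from the first factor and, by induction, [s] copies from the
    rest; [pderC] is what identifies them. *)
Lemma pder_taylor_term s h p i x : holomorphic W h -> W p -> W x ->
  pder i (taylor_term s.+1 h p) x = s.+1%:R * taylor_term s (pder i h) p x.
Proof.
move=> + Wp Wx.
have dc a : differentiable (fun y => coord a y - coord a p) x.
  apply: (@holomorphicB R n W (coord a) (fun=> coord a p) _ _ x Wx).
    exact: holomorphic_coord.
  exact: holomorphic_cst.
have dpc a : pder i (fun y => coord a y - coord a p) x = (i == a)%:R.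
  rewrite (@pderD R n (coord a) (fun=> - coord a p)).
  - by rewrite pder_cst addr0 pder_coord.
  - exact: (@holomorphic_coord R n W a x Wx).
  - exact: differentiable_cst.
have dt s' g : differentiable (taylor_term s' g p) x.
  exact: holomorphic_taylor_term.
have step s' g : pder i (taylor_term s'.+1 g p) x =
    taylor_term s' (pder i g) p x +
    \sum_a (coord a x - coord a p) * pder i (taylor_term s' (pder a g) p) x.
  rewrite pder_sum; last by move=> a; exact: differentiableM.
  under eq_bigr do rewrite pderM// dpc.
  rewrite big_split /= (bigD1 i)//= eqxx mul1r big1 ?addr0// => a ai.
  by rewrite eq_sym (negbTE ai) mul0r.
elim: s h => [|s IH] h hh; rewrite step.
  by rewrite big1 ?addr0 ?mul1r// => a _; rewrite pder_cst mulr0.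
rewrite -[s.+2%:R]natr1 mulrDl mul1r addrC; congr (_ + _).
rewrite [in RHS]/= mulr_sumr; apply: eq_bigr => a _.
rewrite IH; last exact: holomorphic_pder.
by rewrite mulrCA (taylor_term_eq s x (fun y Wy => pderC i a oW hh Wy) Wp).
Qed.

(** Induction works because the partial derivative of the remainder of [h] is the remainder, one
    order lower, of the partial derivative of [h]. *)
Lemma vanishes_taylor N h p : holomorphic W h -> W p ->
  vanishes N (fun x => h x - \sum_(s < N) (s`!%:R)^-1 * taylor_term s h p x) p.
Proof.
move=> + Wp; elim: N h => [//|N IH] h hh.
have hT g m : holomorphic W (fun x =>
    \sum_(s < m) (s`!%:R)^-1 * taylor_term s g p x).
  apply: holomorphic_sum => s _; apply: holomorphicM;
    first exact: holomorphic_cst.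
  exact: holomorphic_taylor_term.
split=> [|i].
  rewrite big_ord_recl /= fact0 invr1 mul1r big1 ?addr0 ?subrr// => s _.
  by rewrite big1 ?mulr0// => i _; rewrite subrr mul0r.
have hi := holomorphic_pder i oW hh.
apply: vanishes_eq (IH _ hi) => // x Wx.
rewrite pderD; [|exact: hh|by apply: differentiableN; exact: hT].
congr (_ + _); rewrite -mulN1r.
under [in RHS]eq_fun do rewrite -mulN1r.
rewrite pderZ; last exact: hT.
congr (_ * _); rewrite pder_sum; last first.
  by move=> s; apply: differentiableM => //; exact: holomorphic_taylor_term.
rewrite big_ord_recl pderZ; last exact: differentiable_cst.
rewrite pder_cst mulr0 add0r.
apply: eq_bigr => s _; rewrite pderZ; last exact: holomorphic_taylor_term.
rewrite pder_taylor_term// mulrA; congr (_ * _).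
by rewrite factS natrM invfM mulrAC mulVf ?mul1r// pnatr_eq0.
Qed.

End IteratedPartials.

(** * Differential operators and multiples of powers of f *)

Section Reduction.
Variables (R : realType) (n : nat).
Local Notation C := (Cplx R).
Local Notation X := (Cn R n).
Variables (W : set X) (f : X -> C).
Implicit Types (u h : X -> C) (x p : X) (w v : seq 'I_n).

(** Unlike [multiple_of_power], nothing is asked at zeros of [f] even for [e >= 0]. This makes the
    notion stable under multiplication by [f], also when [e] passes from -1 to 0. *)
Definition off_zeros_multiple (e : int) (K : X -> C) := exists2 H,
  holomorphic W H & forall p, W p -> f p != 0 -> K p = H p * f p ^ e.

Lemma off_zeros_multiple_eq e K K' : (forall p, W p -> K p = K' p) ->
  off_zeros_multiple e K -> off_zeros_multiple e K'.
Proof. by move=> KK' [H hH HK]; exists H => // p Wp fp; rewrite -KK'// HK. Qed.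

Lemma off_zeros_multiple0 e : off_zeros_multiple e (fun=> 0).
Proof.
by exists (fun=> 0) => [|p _ _]; [exact: holomorphic_cst|rewrite mul0r].
Qed.

Lemma off_zeros_multipleD e K K' : off_zeros_multiple e K ->
  off_zeros_multiple e K' -> off_zeros_multiple e (fun p => K p + K' p).
Proof.
move=> [H hH HK] [H' hH' HK']; exists (fun p => H p + H' p).
  exact: holomorphicD.
by move=> p Wp fp; rewrite HK// HK'// mulrDl.
Qed.

Lemma off_zeros_multipleMl e g K : holomorphic W g -> off_zeros_multiple e K ->
  off_zeros_multiple e (fun p => g p * K p).
Proof.
move=> hg [H hH HK]; exists (fun p => g p * H p); first exact: holomorphicM.
by move=> p Wp fp; rewrite HK// mulrA.
Qed.

Lemma off_zeros_multipleB e K K' : off_zeros_multiple e K ->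
  off_zeros_multiple e K' -> off_zeros_multiple e (fun p => K p - K' p).
Proof.
move=> HK HK'; have := off_zeros_multipleMl (@holomorphic_cst _ _ W (-1)) HK'.
move=> /(off_zeros_multipleD HK); apply: off_zeros_multiple_eq => p _.
by rewrite mulN1r.
Qed.

Lemma off_zeros_multiple_sum e (I : Type) (r : seq I) (F : I -> X -> C) :
  (forall a, off_zeros_multiple e (F a)) ->
  off_zeros_multiple e (fun p => \sum_(a <- r) F a p).
Proof.
move=> HF; elim: r => [|a r IH].
  by under eq_fun do rewrite big_nil; exact: off_zeros_multiple0.
by under eq_fun do rewrite big_cons; exact: off_zeros_multipleD.
Qed.

Lemma off_zeros_multipleMf e K : off_zeros_multiple e K ->
  off_zeros_multiple (e + 1) (fun p => f p * K p).
Proof.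
move=> [H hH HK]; exists H => // p Wp fp.
by rewrite HK// expfzDr// expr1z mulrCA [f p * _]mulrC.
Qed.

Variables (oW : open W) (hf : holomorphic W f) (d : nat) (k : int).
Variable P : (X -> C) -> X -> C.
Hypothesis PD : forall (u v : X -> C) p, holomorphic W u -> holomorphic W v ->
  W p ->
  P (fun x => u x + v x) p = P u p + P v p.
Hypothesis PZ : forall c u p, holomorphic W u -> W p ->
  P (fun x => c * u x) p = c * P u p.
Hypothesis Peq : forall (u v : X -> C) p, holomorphic W u ->
  (forall x, W x -> u x = v x) ->
  W p -> P u p = P v p.
Hypothesis Pkill : forall u p, holomorphic W u -> W p -> vanishes d.+1 u p ->
  P u p = 0.
Hypothesis Ptest : forall w i, (size w + i <= d)%N ->
  off_zeros_multiple (i%:Z - k)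
    (P (fun x => \prod_(a <- w) coord a x * f x ^+ i)).

Lemma operator_sum (I : Type) (r : seq I) (F : I -> X -> C) p : W p ->
  (forall a, holomorphic W (F a)) ->
  P (fun x => \sum_(a <- r) F a x) p = \sum_(a <- r) P (F a) p.
Proof.
move=> Wp hF; elim: r => [|a r IH].
  rewrite big_nil; under eq_fun do rewrite big_nil.
  by apply: (Pkill _ Wp (vanishes0 oW _ Wp)); exact: holomorphic_cst.
rewrite big_cons -IH; under eq_fun do rewrite big_cons.
by rewrite PD//; exact: holomorphic_sum.
Qed.

Definition centred_prod v p x : C := \prod_(a <- v) (coord a x - coord a p).

Lemma holomorphic_centred_coord a p :
  holomorphic W (fun x => coord a x - coord a p).
Proof. by apply: holomorphicB;
  [exact: holomorphic_coord|exact: holomorphic_cst]. Qed.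

Lemma holomorphic_centred_prod v p : holomorphic W (centred_prod v p).
Proof. by apply: holomorphic_prod => a; exact: holomorphic_centred_coord. Qed.

Lemma holomorphic_centredX j p : holomorphic W (fun x => (f x - f p) ^+ j).
Proof.
by apply: holomorphicX; apply: holomorphicB => //; exact: holomorphic_cst.
Qed.

Lemma holomorphic_monomial w i :
  holomorphic W (fun x => \prod_(a <- w) coord a x * f x ^+ i).
Proof.
apply: holomorphicM; last exact: holomorphicX.
by apply: holomorphic_prod => a; exact: holomorphic_coord.
Qed.

(** Opening a factor [x_a - p_a] moves [x_a] into the word [w] and takes [p_a], a constant while [p]
    is fixed, out of [P]; as a function of [p] it is a holomorphic coefficient. *)
Lemma operator_centred_coords v w i : (size v + size w + i <= d)%N ->
  off_zeros_multiple (i%:Z - k) (fun p =>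
    P (fun x => centred_prod v p x * (\prod_(a <- w) coord a x * f x ^+ i)) p).
Proof.
elim: v w => [|a v IH] w le_d.
  apply: off_zeros_multiple_eq (Ptest le_d) => p Wp.
  apply: (Peq _ _ Wp); first exact: holomorphic_monomial.
  by move=> x _; rewrite /centred_prod big_nil mul1r.
have hG w' p : holomorphic W (fun x =>
    centred_prod v p x * (\prod_(a <- w') coord a x * f x ^+ i)).
  by apply: holomorphicM;
    [exact: holomorphic_centred_prod|exact: holomorphic_monomial].
have le1 : (size v + size (a :: w) + i <= d)%N by rewrite /= addnS.
have le2 : (size v + size w + i <= d)%N by apply: ltnW.
have := off_zeros_multipleB (IH _ le1)
  (off_zeros_multipleMl (@holomorphic_coord _ _ W a) (IH _ le2)).
apply: off_zeros_multiple_eq => p Wp.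
have hZ : holomorphic W (fun x => - coord a p *
    (centred_prod v p x * (\prod_(b <- w) coord b x * f x ^+ i))).
  by apply: holomorphicM; [exact: holomorphic_cst|exact: hG].
rewrite -mulNr -(PZ _ (hG w p) Wp) -(PD (hG (a :: w) p) hZ Wp).
apply: (Peq _ _ Wp); first exact: holomorphicD (hG (a :: w) p) hZ.
by move=> x _; rewrite /centred_prod !big_cons; ring.
Qed.

(** Each factor [f - f(p)] splits into [f], which turns [i] into [i.+1], and [f(p)], which
    [off_zeros_multipleMf] turns into one more power of the multiple. Both parts reach the exponent
    [i + j - k]. *)
Lemma operator_centred v w i j : (size v + size w + i + j <= d)%N ->
  off_zeros_multiple ((i + j)%:Z - k) (fun p =>
    P (fun x => (f x - f p) ^+ j *
      (centred_prod v p x * (\prod_(a <- w) coord a x * f x ^+ i))) p).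
Proof.
have hG i' p : holomorphic W (fun x =>
    centred_prod v p x * (\prod_(a <- w) coord a x * f x ^+ i')).
  by apply: holomorphicM;
    [exact: holomorphic_centred_prod|exact: holomorphic_monomial].
elim: j i => [|j IH] i le_d.
  rewrite !addn0 in le_d *.
  apply: off_zeros_multiple_eq (operator_centred_coords le_d) => p Wp.
  by apply: (Peq (hG _ _) _ Wp) => x _; rewrite expr0 mul1r.
have hGj i' p : holomorphic W (fun x => (f x - f p) ^+ j *
    (centred_prod v p x * (\prod_(a <- w) coord a x * f x ^+ i'))).
  by apply: holomorphicM; [exact: holomorphic_centredX|exact: hG].
have le1 : (size v + size w + i.+1 + j <= d)%N by rewrite addnS addSn -addnS.
have le2 : (size v + size w + i + j <= d)%N by rewrite addnS in le_d;
  exact: ltnW.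
have := off_zeros_multipleMf (IH _ le2).
have -> : (i + j)%:Z - k + 1 = (i.+1 + j)%:Z - k by rewrite addSn -addn1
  PoszD; ring.
move=> /(off_zeros_multipleB (IH _ le1)); rewrite addSnnS.
apply: off_zeros_multiple_eq => p Wp.
have hZ : holomorphic W (fun x => - f p * ((f x - f p) ^+ j *
    (centred_prod v p x * (\prod_(a <- w) coord a x * f x ^+ i)))).
  by apply: holomorphicM; [exact: holomorphic_cst|exact: hGj].
rewrite -mulNr -(PZ _ (hGj i p) Wp) -(PD (hGj i.+1 p) hZ Wp).
apply: (Peq _ _ Wp); first exact: holomorphicD (hGj i.+1 p) hZ.
by move=> x _; rewrite !exprS; ring.
Qed.

(** Unfolding the recursion moves the centred coordinates into [v]; what is left at the end is an
    iterated partial of [h] at [p], a holomorphic coefficient. *)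
Lemma operator_taylor_term s h v j : holomorphic W h ->
  (s + size v + j <= d)%N ->
  off_zeros_multiple (j%:Z - k) (fun p =>
    P (fun x =>
      taylor_term s h p x * (centred_prod v p x * (f x - f p) ^+ j)) p).
Proof.
have hG v' p : holomorphic W (fun x => centred_prod v' p x * (f x - f p) ^+ j).
  by apply: holomorphicM;
    [exact: holomorphic_centred_prod|exact: holomorphic_centredX].
elim: s h v => [|s IH] h v hh le_d.
  have le' : (size v + size (@nil 'I_n) + 0 + j <= d)%N by rewrite !addn0.
  have := off_zeros_multipleMl hh (operator_centred le').
  rewrite add0n; apply: off_zeros_multiple_eq => p Wp.
  have hM : holomorphic W (fun x => (f x - f p) ^+ j *
      (centred_prod v p x * (\prod_(a <- [::]) coord a x * f x ^+ 0))).
    apply: holomorphicM; first exact: holomorphic_centredX.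
    apply: holomorphicM; first exact: holomorphic_centred_prod.
    exact: (@holomorphic_monomial [::]).
  rewrite -(PZ _ hM Wp).
  apply: (Peq _ _ Wp); last by move=> x _; rewrite /= big_nil expr0; ring.
  by apply: holomorphicM hM; exact: holomorphic_cst.
have hF a p : holomorphic W (fun x => taylor_term s (pder a h) p x *
    (centred_prod (a :: v) p x * (f x - f p) ^+ j)).
  by apply: holomorphicM; [exact: holomorphic_taylor_term|exact: hG].
have := @off_zeros_multiple_sum (j%:Z - k) _ (index_enum 'I_n) (fun a p =>
  P (fun x => taylor_term s (pder a h) p x *
    (centred_prod (a :: v) p x * (f x - f p) ^+ j)) p).
move=> H; have {}H := H (fun a => IH _ (a :: v) (holomorphic_pder a oW hh) _).
have {}H := H _; apply: off_zeros_multiple_eq (H _) => [p Wp|]; last first.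
  by move=> a; rewrite /= addnS.
rewrite -operator_sum//; apply: (Peq _ _ Wp).
  by apply: holomorphic_sum => a _; exact: hF.
move=> x _; rewrite /= mulr_suml; apply: eq_bigr => a _.
by rewrite /centred_prod big_cons; ring.
Qed.

(** Writing one factor [f] as [(f - f(p)) + f(p)] trades a power in [m] for one in [j] or for one
    outside [P]. This reaches every exponent [m], although the test stops at [d]. *)
Lemma operator_taylor_term_power s h j m : holomorphic W h ->
  off_zeros_multiple ((m + j)%:Z - k) (fun p =>
    P (fun x => taylor_term s h p x * (f x - f p) ^+ j * f x ^+ m) p).
Proof.
move=> hh.
have hT j' p : holomorphic W (fun x => taylor_term s h p x * (f x - f p) ^+ j').
  by apply: holomorphicM;
    [exact: holomorphic_taylor_term|exact: holomorphic_centredX].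
have hG j' m' p : holomorphic W (fun x =>
    taylor_term s h p x * (f x - f p) ^+ j' * f x ^+ m').
  by apply: holomorphicM => //; exact: holomorphicX.
elim: m j => [|m IH] j.
  have [le_d|gt_d] := leqP (s + j) d.
    have le' : (s + size (@nil 'I_n) + j <= d)%N by rewrite addn0.
    apply: off_zeros_multiple_eq (operator_taylor_term hh le') => p Wp.
    apply: (Peq _ _ Wp); last first.
      by move=> x _; rewrite /centred_prod big_nil mul1r expr0 mulr1.
    apply: holomorphicM; first exact: holomorphic_taylor_term.
    by apply: holomorphicM;
      [exact: holomorphic_centred_prod|exact: holomorphic_centredX].
  (* More than [d] factors vanishing at [p] have accumulated, so [P] kills the product. *)
  apply: off_zeros_multiple_eq (off_zeros_multiple0 _) => p Wp; apply/esym.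
  apply: (Pkill (hG _ _ _) Wp).
  have vf : vanishes j (fun x => (f x - f p) ^+ j) p.
    elim: (j) => [//|j' IHj].
    have v1 : vanishes 1 (fun x => f x - f p) p by split; rewrite ?subrr.
    have := vanishesM oW (@holomorphicB _ _ W f (fun=> f p) hf
      (@holomorphic_cst _ _ W (f p))) (holomorphic_centredX j' p) Wp v1 IHj.
    by apply: (vanishes_eq oW _ Wp) => x _; rewrite exprS.
  have vM := vanishesM oW (@holomorphic_taylor_term R n W s h p)
    (holomorphic_centredX j p) Wp (vanishes_taylor_term oW s h Wp) vf.
  apply: (vanishes_eq oW _ Wp (vanishesW gt_d vM)) => x _.
  by rewrite expr0 mulr1.
have := off_zeros_multipleMf (IH j).
have -> : (m + j)%:Z - k + 1 = (m + j.+1)%:Z - k by rewrite addnS -addn1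
  PoszD; ring.
move=> /(off_zeros_multipleD (IH j.+1)); rewrite -addSnnS.
apply: off_zeros_multiple_eq => p Wp.
have hZ : holomorphic W (fun x =>
    f p * (taylor_term s h p x * (f x - f p) ^+ j * f x ^+ m)).
  by apply: holomorphicM; [exact: holomorphic_cst|exact: hG].
rewrite -(PZ _ (hG j m p) Wp) -(PD (hG j.+1 m p) hZ Wp).
apply: (Peq _ _ Wp); first exact: holomorphicD (hG j.+1 m p) hZ.
by move=> x _; rewrite !exprS; ring.
Qed.

Lemma operator_multiple h m : holomorphic W h ->
  off_zeros_multiple (m%:Z - k) (P (fun x => h x * f x ^+ m)).
Proof.
move=> hh.
have hG s p : holomorphic W (fun x => (s`!%:R)^-1 *
    (taylor_term s h p x * (f x - f p) ^+ 0 * f x ^+ m)).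
  apply: holomorphicM; first exact: holomorphic_cst.
  apply: holomorphicM; last exact: holomorphicX.
  apply: holomorphicM; last exact: holomorphic_centredX.
  exact: holomorphic_taylor_term.
have := @off_zeros_multiple_sum (m%:Z - k) _ (index_enum 'I_d.+1) (fun s p =>
  (s`!%:R)^-1 * P (fun x =>
    taylor_term s h p x * (f x - f p) ^+ 0 * f x ^+ m) p).
move=> H; apply: off_zeros_multiple_eq (H _) => [p Wp|s]; last first.
  apply: (@off_zeros_multipleMl _ (fun=> (s`!%:R)^-1)).
    exact: holomorphic_cst.
  by have := operator_taylor_term_power s 0 m hh; rewrite addn0.
pose r x : C := h x - \sum_(s < d.+1) (s`!%:R)^-1 * taylor_term s h p x.
have hr : holomorphic W r.
  apply: holomorphicB => //; apply: holomorphic_sum => s _.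
  by apply: holomorphicM;
    [exact: holomorphic_cst|exact: holomorphic_taylor_term].
have hrf : holomorphic W (fun x => r x * f x ^+ m).
  by apply: holomorphicM => //; exact: holomorphicX.
have Pr : P (fun x => r x * f x ^+ m) p = 0.
  apply: (Pkill hrf Wp); rewrite -[d.+1]addn0.
  have vr := vanishes_taylor oW d.+1 hh Wp.
  have hfm : holomorphic W (fun x => f x ^+ m) by exact: holomorphicX.
  exact: (@vanishesM R n W oW d.+1 0 r (fun x => f x ^+ m) p hr hfm Wp vr I).
have hGf : holomorphic W (fun x => \sum_(s < d.+1) (s`!%:R)^-1 *
    (taylor_term s h p x * (f x - f p) ^+ 0 * f x ^+ m)).
  by apply: holomorphic_sum => s _; exact: hG.
transitivity (P (fun x => (\sum_(s < d.+1) (s`!%:R)^-1 *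
    (taylor_term s h p x * (f x - f p) ^+ 0 * f x ^+ m)) + r x * f x ^+ m) p).
  rewrite (PD hGf hrf Wp) Pr addr0 operator_sum//.
  apply: eq_bigr => s _; apply/esym/(PZ _ _ Wp).
  apply: holomorphicM; last exact: holomorphicX.
  apply: holomorphicM; last exact: holomorphic_centredX.
  exact: holomorphic_taylor_term.
apply: (Peq _ _ Wp); first exact: holomorphicD hGf hrf.
move=> x _; rewrite /r mulrBl mulr_suml.
under eq_bigr do rewrite expr0 mulr1 mulrA.
by rewrite addrC subrK.
Qed.

End Reduction.

(** * Linearity, locality and order of a differential operator *)

Section Operators.
Variables (R : realType) (n : nat).
Local Notation C := (Cplx R).
Local Notation X := (Cn R n).
Variables (d : nat) (U : set X) (P : (X -> C) -> X -> C).
Hypothesis hP : diffop_order d U P.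
Variables (W : set X) (oW : open W) (WU : W `<=` U).
Implicit Types (u v : X -> C) (p : X).

Lemma holomorphic_mpartial (b : 'I_n -> nat) u :
  holomorphic W u -> holomorphic W (mpartial b u).
Proof.
by move=> hu; have [w _ ->] := mpartialE R b; exact: holomorphic_pders.
Qed.

Lemma holomorphic_diffop u : holomorphic W u -> holomorphic W (P u).
Proof.
move=> hu; have [a ha Pa] := hP.
apply: (@holomorphic_eq _ _ W _ (P u) oW (fun x Wx =>
  esym (Pa W u oW WU hu x Wx))).
apply: holomorphic_sum => b _; apply: holomorphicM.
  exact: holomorphicS WU (ha b).
exact: holomorphic_mpartial.
Qed.

Lemma diffopD u v p : holomorphic W u -> holomorphic W v -> W p ->
  P (fun x => u x + v x) p = P u p + P v p.
Proof.
move=> hu hv Wp; have [a ha Pa] := hP.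
rewrite (Pa W _ oW WU (holomorphicD hu hv) p Wp) (Pa W u oW WU hu p Wp).
rewrite (Pa W v oW WU hv p Wp) -big_split /=; apply: eq_bigr => b _.
by have [w _ wE] := mpartialE R (fun i => b i);
  rewrite !wE (pdersD oW w hu hv Wp) mulrDr.
Qed.

Lemma diffopZ c u p : holomorphic W u -> W p ->
  P (fun x => c * u x) p = c * P u p.
Proof.
move=> hu Wp; have [a ha Pa] := hP.
rewrite (Pa W _ oW WU (holomorphicM (holomorphic_cst c) hu) p Wp).
rewrite (Pa W u oW WU hu p Wp) mulr_sumr; apply: eq_bigr => b _.
by have [w _ wE] := mpartialE R (fun i => b i);
  rewrite !wE (pdersZ oW w c hu Wp) mulrCA.
Qed.

Lemma diffop_eq u v p : holomorphic W u -> (forall x, W x -> u x = v x) ->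
  W p -> P u p = P v p.
Proof.
move=> hu uv Wp; have [a ha Pa] := hP.
rewrite (Pa W u oW WU hu p Wp) (Pa W v oW WU (holomorphic_eq oW uv hu) p Wp).
apply: eq_bigr => b _.
have [w _ wE] := mpartialE R (fun i => b i).
by rewrite !wE (pders_eq oW w uv Wp).
Qed.

Lemma diffop_vanishes u p : holomorphic W u -> W p -> vanishes d.+1 u p ->
  P u p = 0.
Proof.
move=> hu Wp up; have [a ha Pa] := hP.
rewrite (Pa W u oW WU hu p Wp) big1// => b bd.
have [w sw wE] := mpartialE R (fun i => b i); rewrite wE.
have [|-> _] := @vanishes_pders R n w 1 u p; last by rewrite mulr0.
by apply: vanishesW up; rewrite addn1 sw ltnS.
Qed.

End Operators.

(** * Principal divisors and powers of their ideals *)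

Section PrincipalDivisors.
Variables (R : realType) (n : nat).
Local Notation C := (Cplx R).
Local Notation X := (Cn R n).
Variables (D : set X) (f : X -> C).
Hypothesis hD : principal_divisor D f.
Implicit Types (W : set X) (g u v : X -> C) (p x : X).

Lemma ideal_sheaf_generator W : open W -> ideal_sheaf D W f.
Proof.
move=> oW; have [_ /(_ W f oW)[_]] := hD; apply.
by exists (fun=> 1); [exact: holomorphic_cst|move=> x _ _;
  rewrite mul1r expr1z].
Qed.

(** If [f] vanished on [W], so would the local equation [h] of [D] near [p], being a multiple of
    [f]; but the zero set of [h] has empty interior. *)
Lemma generator_neq0 W p : open W -> W p -> exists2 x, W x & f x != 0.
Proof.
move=> oW Wp; apply: contrapT => fW.
have f0 x : W x -> f x = 0.
  by move=> Wx; apply/eqP; apply: contrapT => /negP fx; apply: fW; exists x.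
have [/(_ p)[V [h [oV Vp hh int0 DV]]] DE] := hD.
have oWV : open (W `&` V) by exact: openI.
have /(DE _ _ oWV)[H _ HE] : ideal_sheaf D (W `&` V) h.
  split; first by apply: holomorphicS hh => x [].
  move=> x [_ Vx] Dx; have : (D `&` V) x by [].
  by rewrite DV => -[].
have : (V `&` [set x | h x = 0])° p.
  apply: filterS (open_nbhs_nbhs (conj oWV (conj Wp Vp))).
  move=> x [Wx Vx]; split=> //=.
  by rewrite HE//; [rewrite f0// expr1z mulr0|left].
by rewrite int0.
Qed.

(** Were [u - v] nonzero at [p], it would be nonzero on a neighbourhood, and that contains a point
    where [f] is nonzero. *)
Lemma holomorphic_eq_off_zeros W u v : open W -> holomorphic W u ->
  holomorphic W v -> (forall x, W x -> f x != 0 -> u x = v x) ->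
  forall x, W x -> u x = v x.
Proof.
move=> oW hu hv uv p Wp; apply/eqP; rewrite -subr_eq0;
  apply: contrapT => /negP uvp.
have cuv : {for p, continuous (fun x => u x - v x)}.
  apply: differentiable_continuous.
  by have := holomorphicB hu hv; apply.
have near_p : \forall x \near p, W x /\ u x - v x != 0.
  near=> x; split; first by near: x; exact: open_nbhs_nbhs.
  near: x; exact: (cvgr_neq0 _ cuv uvp).
have [x Vx fx] := generator_neq0 (@open_interior X _) near_p.
by have [Wx] := interior_subset Vx; rewrite uv// subrr eqxx.
Unshelve. all: by end_near. Qed.

Lemma ideal_power_multiple m W g : open W -> ideal_power D m W g ->
  exists2 h, holomorphic W h & forall x, W x -> g x = h x * f x ^+ m.
Proof.
move=> oW [N [c [s [hc hs gE]]]]; have [_ DE] := hD.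
have /choice[q hq] : forall ij : 'I_N * 'I_m, exists h, holomorphic W h /\
    forall x, W x -> s ij.1 ij.2 x = h x * f x.
  move=> [i j]; have /(DE _ _ oW)[h hh hE] := hs i j.
  by exists h; split=> // x Wx; rewrite hE ?expr1z//; left.
exists (fun x => \sum_i c i x * \prod_j q (i, j) x).
  apply: holomorphic_sum => i _; apply: holomorphicM => //.
  by apply: holomorphic_prod => j; have [] := hq (i, j).
move=> x Wx; rewrite gE// mulr_suml; apply: eq_bigr => i _.
rewrite -mulrA; congr (_ * _).
under eq_bigr => j _ do rewrite (hq (i, j)).2//.
by rewrite big_split /= prodr_const card_ord.
Qed.

Lemma multiple_ideal_power m W g h : open W -> holomorphic W h ->
  (forall x, W x -> g x = h x * f x ^+ m) -> ideal_power D m W g.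
Proof.
move=> oW hh gE; exists 1%N, (fun=> h), (fun _ _ => f); split=> // [_ _|x Wx].
  exact: ideal_sheaf_generator.
by rewrite big_ord1 prodr_const card_ord gE.
Qed.

End PrincipalDivisors.

Lemma monomial_count (R : realType) (n : nat) (w : seq 'I_n) (x : Cn R n) :
  monomial (fun i => count_mem i w) x = \prod_(a <- w) coord a x.
Proof.
rewrite /monomial; elim: w => [|a w IH].
  by rewrite big_nil big1// => i _; rewrite expr0.
rewrite big_cons -IH /= (bigD1 a)//= [in RHS](bigD1 a)//= eqxx exprS -mulrA.
congr (_ * (_ * _)); apply: eq_bigr => i ia.
by rewrite eq_sym (negbTE ia).
Qed.

Lemma sum_count (n : nat) (w : seq 'I_n) :
  (\sum_i count_mem i w)%N = size w.
Proof.
elim: w => [|a w IH]; first by rewrite big1.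
rewrite /= big_split /= IH (bigD1 a)//= eqxx big1 ?addn0// => i ia.
by rewrite eq_sym (negbTE ia).
Qed.

(** * The two implications of the criterion *)

Section Proposition8.
Variables (R : realType) (n : nat).
Local Notation C := (Cplx R).
Local Notation X := (Cn R n).
Variables (D : set X) (f : X -> C).
Hypotheses (hf : holomorphic setT f) (hD : principal_divisor D f).
Variables (k : int) (d : nat) (U : set X) (oU : open U).
Variable P : (X -> C) -> X -> C.
Hypothesis hP : diffop_order d U P.

Lemma V_filtration_test : V_filtration D k U P ->
  forall (a : 'I_n -> nat) (l : nat), (\sum_i a i + l <= d)%N ->
    multiple_of_power f (l%:Z - k) U (P (fun x => monomial a x * f x ^+ l)).
Proof.
move=> [_ HV] a l _; pose g x : C := monomial a x * f x ^+ l; rewrite -/g.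
have hm : holomorphic U (monomial a).
  apply: holomorphic_prod => i; apply: holomorphicX; exact: holomorphic_coord.
have hfU : holomorphic U f by exact: holomorphicS hf.
have hg : holomorphic U g by apply: holomorphicM => //; exact: holomorphicX.
have hPg : holomorphic U (P g) by exact: (holomorphic_diffop hP oU).
have /(HV _ _ _ oU) : ideal_sheaf_power D l%:Z U g.
  move=> p Up; exists U; split=> //.
  exact: (multiple_ideal_power hD oU hm).
move=> /(_ (@subset_refl _ U)); case: (l%:Z - k) => e HPg; last first.
  (* For a negative exponent, [Negz e] stands for [-(e + 1)], and the equation is required only
     where [f] can be inverted. *)
  exists (fun x => P g x * f x ^+ e.+1).
    by apply: holomorphicM => //; exact: holomorphicX.
  by move=> x Ux [//|fx]; rewrite NegzE -exprnN mulfK// expf_neq0.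
(* The sheaf condition yields only local quotients; one is chosen near each point. They agree on
   overlaps, since they do so off the zeros of [f]. *)
have /choice[WH HWH] : forall p, exists WH : set X * (X -> C), U p ->
    [/\ open WH.1, WH.1 p, WH.1 `<=` U, holomorphic WH.1 WH.2 &
        forall x, WH.1 x -> P g x = WH.2 x * f x ^+ e].
  move=> p; have [Up|nUp] := pselect (U p); last by exists (set0, f).
  have [W [oW Wp WU /(ideal_power_multiple hD oW)[h hh hE]]] := HPg p Up.
  by exists (W, h).
have glue p x : U p -> (WH p).1 x -> (WH x).2 x = (WH p).2 x.
  move=> Up Wpx; have [oW _ WU hW WE] := HWH p Up.
  have [oW' Wx' _ hW' WE'] := HWH x (WU x Wpx).
  apply: (holomorphic_eq_off_zeros hD (openI oW oW')) => //.
  - by apply: holomorphicS hW' => y [].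
  - by apply: holomorphicS hW => y [].
  - move=> y [Wy Wy'] fy; apply: (mulIf (expf_neq0 e fy)).
    by rewrite -WE'// -WE.
(* The global quotient takes at [x] the value of the quotient chosen at [x]; near [p] this is the
   single function [(WH p).2]. *)
exists (fun x => (WH x).2 x).
  move=> p Up; have [oW Wp _ hW _] := HWH p Up.
  apply: near_eq_differentiable (hW p Wp).
  by apply: (open_near_eq oW Wp) => x Wx; rewrite (glue p x).
by move=> x Ux _; have [_ Wx _ _ WE] := HWH x Ux; rewrite (WE x Wx).
Qed.

Hypothesis test : forall (a : 'I_n -> nat) (l : nat),
  (\sum_i a i + l <= d)%N ->
  multiple_of_power f (l%:Z - k) U (P (fun x => monomial a x * f x ^+ l)).

Lemma diffop_multiple W h m : open W -> W `<=` U -> holomorphic W h ->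
  off_zeros_multiple W f (m%:Z - k) (P (fun x => h x * f x ^+ m)).
Proof.
move=> oW WU hh; apply: (@operator_multiple R n W f oW _ d k P) => //.
- exact: holomorphicS hf.
- exact: (diffopD hP oW WU).
- exact: (diffopZ hP oW WU).
- exact: (diffop_eq hP oW WU).
- exact: (diffop_vanishes hP oW WU).
move=> w i wi; have [|H hH HE] := @test (fun j => count_mem j w) i.
  by rewrite sum_count.
exists H; first exact: holomorphicS hH.
move=> p Wp fp; rewrite -HE; [|exact: WU|by right].
by congr (P _ p); apply/funext => x; rewrite monomial_count.
Qed.

Lemma test_V_filtration : V_filtration D k U P.
Proof.
split; first by move=> p Up; exists U, d; split=> //; exact: subset_refl.
move=> l W g oW WU Hg p Wp; have [W' [oW' Wp' W'W Hp]] := Hg p Wp.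
exists W'; split=> //; have W'U := subset_trans W'W WU.
set m := (if l is Posz m then m else 0%N) in Hp.
have lm : l <= m%:Z by rewrite /m; case: (l).
have [h hh gE] := ideal_power_multiple hD oW' Hp.
have hfW : holomorphic W' f by exact: holomorphicS hf.
have hhf : holomorphic W' (fun x => h x * f x ^+ m).
  by apply: holomorphicM => //; exact: holomorphicX.
have hg : holomorphic W' g.
  by apply: holomorphic_eq hhf => // x Wx; rewrite gE.
have hPg := holomorphic_diffop hP oW' W'U hg.
have PgE x : W' x -> P g x = P (fun x => h x * f x ^+ m) x.
  by move=> Wx; exact: (diffop_eq hP oW' W'U hg gE Wx).
have [H hH HE] := diffop_multiple m oW' W'U hh.
(* When [l - k] is negative, the target is the zeroth power, all of [O], and holomorphy of [P g]
   suffices. *)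
case El : (l - k) => [e|e]; last first.
  by apply: (multiple_ideal_power hD oW' hPg) => x _; rewrite expr0 mulr1.
have [q qE] : exists q : nat, m%:Z - l = q%:Z.
  by case: (m%:Z - l) (subr_ge0 l m%:Z) => [q|q]; [exists q|rewrite lm].
(* For [l < 0] the ideal power has exponent [m = 0 > l]; the surplus [q = m - l] is absorbed into
   the coefficient. *)
apply: (multiple_ideal_power hD oW' (h := fun x => H x * f x ^+ q)).
  by apply: holomorphicM => //; exact: holomorphicX.
apply: (holomorphic_eq_off_zeros hD oW' hPg).
  apply: holomorphicM; last exact: holomorphicX.
  by apply: holomorphicM => //; exact: holomorphicX.
move=> x Wx fx; rewrite PgE// HE//.
have -> : m%:Z - k = (q + e)%:Z by rewrite PoszD -qE -El; ring.
by rewrite -mulrA -exprD.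
Qed.

End Proposition8.

Theorem proposition8 (R : realType) (n : nat) (hn : (2 <= n)%N)
    (D : set (Cn R n)) (f : Cn R n -> Cplx R)
    (hf : holomorphic setT f) (hD : principal_divisor D f)
    (k : int) (d : nat) (U : set (Cn R n)) (hU : open U)
    (P : (Cn R n -> Cplx R) -> (Cn R n -> Cplx R))
    (hP : diffop_order d U P) :
  V_filtration D k U P <->
  (forall (a : 'I_n -> nat) (l : nat), (\sum_i a i + l <= d)%N ->
     multiple_of_power f (l%:Z - k) U
       (P (fun x => monomial a x * f x ^+ l))).
Proof. by split; [exact: V_filtration_test|exact: test_V_filtration]. Qed.
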